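(* The upper density of half-infinite unit-radius circular cylinders in $\mathbb{R}^3$ is exactly $\pi/\sqrt{12}$; that is, $$\sup_{\mathscr{C}}\ \gamma^+(\mathscr{C}) = \frac{\pi}{\sqrt{12}},$$ where the supremum is over all packings $\mathscr{C}$ of $\mathbb{R}^3$ by half-infinite circular cylinders of unit radius.
   Context: A half-infinite circular cylinder of unit radius is a set of the form $\{p+su+v : s\ge 0,\ v\perp u,\ |v|\le 1\}\subseteq\mathbb{R}^3$ with $p\in\mathbb{R}^3$ and $u$ a unit vector. A packing of $\mathbb{R}^3$ by such cylinders is a countable family $\mathscr{C}=\{C_i\}_{i\in I}$ of them with mutually disjoint interiors. With $B(r)$ the closed ball of radius $r$ centered at $0$, the upper density of such a packing is $$\gamma^+(\mathscr{C})=\limsup_{r\to\infty}\ \sum_{i\in I}\frac{\mathrm{Vol}(C_i\cap B(r))}{\mathrm{Vol}(B(r))}.$$ *)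

(* Defs.v *)
From HB Require Import structures.
From mathcomp Require Import all_boot all_order all_algebra.
From mathcomp Require Import all_classical all_reals all_analysis.

Set Implicit Arguments.
Unset Strict Implicit.
Unset Printing Implicit Defensive.

Import Order.TTheory GRing.Theory Num.Theory.
Import numFieldNormedType.Exports.

Local Open Scope classical_set_scope.
Local Open Scope ring_scope.

(* A plain product type, so that the product topology and the product Borel
   sigma-algebra are both inferred.  The library norm on it is the sup norm,
   hence the separate Euclidean norm [enorm]. *)
Notation R3 R := (R * R * R)%type.

Section CylinderPackings.
Context {R : realType}.
Implicit Types (x y u v p : R3 R) (A : set (R3 R)).

Definition dot x y : R := x.1.1 * y.1.1 + x.1.2 * y.1.2 + x.2 * y.2.

Definition enorm x : R := Num.sqrt (dot x x).

Definition eball (r : R) : set (R3 R) := [set x | enorm x <= r].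

(* The factor [lebesgue_measure] lives on the Borel sets, so this is
   three-dimensional Lebesgue measure restricted to the Borel sets; it is not
   meaningful on other sets, but it is only applied to intersections of closed
   cylinders and balls. *)
Definition vol A : \bar R :=
  ((@lebesgue_measure R \x @lebesgue_measure R) \x @lebesgue_measure R)%E A.

Definition half_cylinder p u : set (R3 R) :=
  [set x | exists (s : R) (v : R3 R),
     [/\ 0 <= s, dot v u = 0, enorm v <= 1 & x = p + s *: u + v]].

Definition is_half_cylinder A : Prop :=
  exists p u, enorm u = 1 /\ A = half_cylinder p u.

(* A [countType] may be finite or empty. *)
Definition packing (I : countType) (C : I -> set (R3 R)) : Prop :=
  (forall i, is_half_cylinder (C i)) /\
  trivIset [set: I] (fun i => (C i)°).

(* The limsup is along all real radii [r] tending to +oo. *)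
Definition upper_density (I : countType) (C : I -> set (R3 R)) : \bar R :=
  limf_esup
    (fun r : R =>
       \esum_(i in [set: I]) (vol (C i `&` eball r) / vol (eball r)))%E
    (pinfty_nbhs R).

End CylinderPackings.

(* Main.v *)
Require Import Defs.
From HB Require Import structures.
From mathcomp Require Import all_boot all_order all_algebra.
From mathcomp Require Import all_classical all_reals all_analysis.
From mathcomp Require Import measurable_realfun ring lra.
Set Implicit Arguments. Unset Strict Implicit. Unset Printing Implicit Defensive.
Import Order.TTheory GRing.Theory Num.Theory.
Import numFieldNormedType.Exports.
Local Open Scope classical_set_scope.
Local Open Scope ring_scope.

(** Upper bound. Each cylinder is compared with the Dirichlet cell of its axis:
    the points within [rho = 2 / sqrt 3] of this axis and nearer to it than to
    any other axis. The cells are disjoint. A cross-section of a cylinder has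
    area [pi], so a density of at most [pi / sqrt 12] follows if, away from the
    ends of the cylinders, every cross-section of a cell has area at least
    [sqrt 12] ([area_slice_cell], [vol_cylinder_cell]).

    In the plane through a point of an axis and perpendicular to it, the points
    nearer to some other line than to the axis form the region [0 <= Q], where
    [Q] is a square of a linear form plus an affine function: the region lies
    beyond a parabola. Away from the ends, two axes are at distance at least [2]
    ([axes_apart]). Hence the region misses the unit disc, and the directions in
    which the circle of radius [rho] meets it form a convex cone with opening at
    most a right angle ([slice_acute], [slice_convex], [cone_wedge]). The cones
    of different lines are disjoint, because three points at mutual distance at
    least [2] do not lie in an open ball of radius [rho] ([three_far_points]).
    So the question is local to one cone: the part of the disc of radius [rho]
    in the cone and on the near side of the parabola must be at least the
    fraction [sqrt 12 / (pi * rho ^ 2)] of the sector ([area_sector_below]). The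
    extreme case is a straight chord tangent to the unit disc, which cuts off a
    sixth of the circle: this is the regular hexagon. In general the part
    contains a triangle and a piece bounded by a parabola, whose areas are
    compared with that of the sector by two inequalities on concave functions of
    one angle ([chord_trig], [parabola_trig]).

    Near the ends nothing is claimed, but the ends are few: each end within
    [r + 8] of the origin accounts for a stretch of length [r + 8] of its own
    cylinder, so there are [O(r ^ 2)] of them ([vol_near_end]), which is
    negligible against the volume of the ball ([vol_cylinders],
    [upper_density_le]).

    Lower bound. Cylinders that point up and down from the points of the
    hexagonal lattice of minimal distance [2] in a horizontal plane have density
    [pi / sqrt 12], since their cells are prisms over rectangles of sides [2] and
    [sqrt 3] ([vol_hex_cell], [upper_density_hex]).

    Volumes are integrals of areas of cross-sections, in an orthonormal frame
    chosen for each axis. Such a frame preserves the product measure because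
    rotations are products of shears ([preserves_rot2], [exists_frame]). *)

(** * Countable families of sets, and maps that preserve a measure *)

Section MeasurePreserving.
Context {R : realType}.
Implicit Types (d : measure_display).

Lemma measurable_set_lt d (T : measurableType d) (f g : T -> R) :
  measurable_fun setT f -> measurable_fun setT g ->
  measurable [set x | f x < g x].
Proof.
move=> mf mg; have := measurable_fun_ltr mf mg => /(_ measurableT [set true] I).
by rewrite setTI; congr measurable; apply/seteqP; split => x /=.
Qed.

Lemma measurable_set_le d (T : measurableType d) (f g : T -> R) :
  measurable_fun setT f -> measurable_fun setT g ->
  measurable [set x | f x <= g x].
Proof.
move=> mf mg; have := measurable_fun_ler mf mg => /(_ measurableT [set true] I).
by rewrite setTI; congr measurable; apply/seteqP; split => x /=.
Qed.

Definition preserves d (T : measurableType d) (mu : set T -> \bar R)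
    (f : T -> T) : Prop :=
  measurable_fun setT f /\
  forall A, measurable A -> mu (f @^-1` A) = mu A.

Lemma measurable_preimage d1 d2 (T1 : measurableType d1)
    (T2 : measurableType d2) (f : T1 -> T2) A :
  measurable_fun setT f -> measurable A -> measurable (f @^-1` A).
Proof. by move=> mf mA; rewrite -[_ @^-1` _]setTI; exact: mf. Qed.

Lemma preserves_comp d (T : measurableType d) (mu : set T -> \bar R) f g :
  preserves mu f -> preserves mu g -> preserves mu (f \o g).
Proof.
move=> [mf pf] [mg pg]; split; first exact: measurableT_comp.
by move=> A mA; rewrite comp_preimage pg ?pf//; exact: measurable_preimage.
Qed.

Lemma preserves_shift (c : R) :
  preserves (@lebesgue_measure R) (fun x => x + c).
Proof.
have mf : measurable_fun setT (fun x : R => x + c).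
  by apply: measurable_funD => //; exact: measurable_cst.
split=> // A mA.
pose f := fun x : R => x + c.
suff : pushforward (@lebesgue_measure R) (f : R -> measurableTypeR R) A
    = lebesgue_measure A by [].
apply/esym/lebesgue_measure_unique => //= _ [[a b]] _ <-.
rewrite /pushforward (_ : _ @^-1` _ = `](a - c), (b - c)]%classic).
  rewrite !lebesgue_measure_itv/= !lte_fin ltrD2r.
  by case: ifP => // _; rewrite -!EFinB; congr _%:E; ring.
by apply/seteqP; split => x /=; rewrite !in_itv/= ltrBlDr lerBrDr.
Qed.

Lemma eq_preserves d (T : measurableType d) (mu : set T -> \bar R) f g :
  f =1 g -> preserves mu f -> preserves mu g.
Proof. by move=> /funext ->. Qed.

Section Product.
Context d1 d2 (T1 : measurableType d1) (T2 : measurableType d2).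
Variables (m1 : {sigma_finite_measure set T1 -> \bar R})
          (m2 : {sigma_finite_measure set T2 -> \bar R}).
Local Open Scope ereal_scope.

(** Cavalieri along the second factor; the product measure integrates sections
    along the first one by definition, and Tonelli exchanges the two. *)
Lemma prod_measure_ysection A : measurable A ->
  (m1 \x m2) A = \int[m2]_y m1 (ysection A y).
Proof.
move=> mA; have := indic_fubini_tonelli m1 m2 mA.
by rewrite indic_fubini_tonelli_FE// indic_fubini_tonelli_GE.
Qed.

Lemma preserves_fiber_snd (g : T1 -> T2 -> T2) :
  measurable_fun setT (fun z : T1 * T2 => (z.1, g z.1 z.2)) ->
  (forall x, preserves m2 (g x)) ->
  preserves (m1 \x m2) (fun z : T1 * T2 => (z.1, g z.1 z.2)).
Proof.
move=> mf pg; split => // A mA.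
apply: eq_integral => x _ /=.
rewrite -[RHS](pg x).2; last by apply: measurable_xsection; exact: mA.
by congr (m2 _); apply/seteqP; split => y; rewrite /xsection /= !inE.
Qed.

Lemma preserves_fiber_fst (g : T2 -> T1 -> T1) :
  measurable_fun setT (fun z : T1 * T2 => (g z.2 z.1, z.2)) ->
  (forall x, preserves m1 (g x)) ->
  preserves (m1 \x m2) (fun z : T1 * T2 => (g z.2 z.1, z.2)).
Proof.
move=> mf pg; split => // A mA.
rewrite !prod_measure_ysection//; last exact: measurable_preimage.
apply: eq_integral => x _ /=.
rewrite -[RHS](pg x).2; last by apply: measurable_ysection; exact: mA.
by congr (m1 _); apply/seteqP; split => y; rewrite /ysection /= !inE.
Qed.

(** Volumes are compared in this form: slice by slice, in coordinates adapted
    to an axis. *)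
Lemma le_prod_ysection (k : R) A B : (0 <= k)%R ->
  measurable A -> measurable B ->
  (forall y, m1 (ysection A y) <= k%:E * m1 (ysection B y)) ->
  (m1 \x m2) A <= k%:E * (m1 \x m2) B.
Proof.
move=> k0 mA mB AB; rewrite !prod_measure_ysection//.
rewrite -ge0_integralZl//; last exact: measurable_fun_ysection.
apply: ge0_le_integral => //.
- exact: measurable_fun_ysection.
- by apply: measurable_funeM; exact: measurable_fun_ysection.
Qed.

End Product.

Lemma esum_measure_disjoint d (T : measurableType d)
    (mu : {measure set T -> \bar R}) (I : choiceType) (A : I -> set T) X :
  (forall i, measurable (A i)) -> measurable X -> trivIset setT A ->
  (forall i, A i `<=` X) ->
  (\esum_(i in [set: I]) mu (A i) <= mu X)%E.
Proof.
move=> mA mX tA AX; apply: ge_ereal_sup => _ [F [finF _] <-].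
rewrite -measure_fin_bigcup//; last exact: sub_trivIset tA.
apply: le_measure; rewrite ?inE//; last by move=> x [i _ /AX].
by apply: fin_bigcup_measurable.
Qed.

Lemma measure_le_esum d (T : measurableType d)
    (mu : {measure set T -> \bar R}) (I : countType) (A : I -> set T) X :
  (forall i, measurable (A i)) -> measurable X ->
  X `<=` \bigcup_i A i ->
  (mu X <= \esum_(i in [set: I]) mu (A i))%E.
Proof.
move=> mA mX XA.
(* The enumeration of [I] by [pickle] leaves gaps, filled by the empty set. *)
pose B n := if @pickle_inv I n is Some i then A i else set0.
have mB n : measurable (B n) by rewrite /B; case: pickle_inv.
have XB : X `<=` \bigcup_n B n.
  move=> x /XA [i _ Aix]; exists (pickle i) => //.
  by rewrite /B pickleK_inv.
have := measure_sigma_subadditive mu mB mX XB.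
move=> /le_trans; apply.
rewrite nneseries_esumT//.
have B0 n : ~ range (@pickle I) n -> mu (B n) = 0%E.
  rewrite /B; have := @pickle_invK I n; case: (pickle_inv _) => [i|]//= <-.
  by case; exists i.
rewrite (esumID (range (@pickle I))) // setTI.
rewrite [X in (_ + X)%E]esum1 ?adde0; last by move=> n [_ /B0].
rewrite (@reindex_esum R I nat setT _ (@pickle I)); last first.
  by apply: inj_bij => x y _ _; exact: (pcan_inj (@pickleK I)).
by apply: le_esum => i _; rewrite /B pickleK_inv.
Qed.

End MeasurePreserving.

Lemma le_esum_mul (R : realType) (I : choiceType) (k : R) (f g : I -> \bar R) :
  0 <= k -> (forall i, 0 <= g i)%E -> (forall i, f i <= k%:E * g i)%E ->
  (\esum_(i in [set: I]) f i <= k%:E * \esum_(i in [set: I]) g i)%E.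
Proof.
move=> k0 g0 fg; apply: ge_ereal_sup => _ [F [finF _] <-].
apply: (@le_trans _ _ (\sum_(i \in F) (k%:E * g i))%E).
  by apply: lee_fsum.
rewrite -ge0_mule_fsumr//; apply: lee_wpmul2l; first by rewrite lee_fin.
by apply: esum_ge; exists F.
Qed.

Lemma measure_fin d (T : measurableType d) (R : realType)
    (mu : {measure set T -> \bar R}) (A B : set T) (r : R) :
  measurable A -> measurable B -> A `<=` B -> mu B = r%:E ->
  exists2 x : R, 0 <= x & mu A = x%:E.
Proof.
move=> mA mB AB Br; have A0 := measure_ge0 mu A.
have Afin : mu A \is a fin_num.
  rewrite ge0_fin_numE//.
  by apply: (@le_lt_trans _ _ (mu B)); [apply: le_measure; rewrite ?inE | rewrite Br ltry].
by exists (fine (mu A)); [exact: fine_ge0 | rewrite fineK].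
Qed.

Lemma countable_bigcap_measurable d (T : measurableType d) (I : countType)
    (J : set I) (F : I -> set T) : (forall i, measurable (F i)) ->
  measurable (\bigcap_(i in J) F i).
Proof.
move=> mF; rewrite bigcap_mkcond -[X in measurable X]setCK setC_bigcap.
apply: measurableC; apply: countable_bigcupT_measurable => // i.
by apply: measurableC; case: ifP.
Qed.

Ltac mfun := repeat first
  [ exact: measurable_cst | exact: measurable_id | exact: measurable_fst
  | exact: measurable_snd
  | apply: measurable_fun_pair | apply: measurable_funD
  | apply: measurable_funN | apply: measurable_funM
  | apply: measurable_funX | assumption
  | (apply: measurableT_comp; [exact: measurable_fst |])
  | (apply: measurableT_comp; [exact: measurable_snd |]) ].

(** * Rotations and translations preserve the measures of the plane and of space *)

Section Frames.
Context {R : realType}.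
Local Notation lam := (@lebesgue_measure R).
Local Notation R2 := (R * R)%type.

(** [area] and [vol3] are product measures under a name of their own, so that
    they carry measure structures; [vol3] is [vol]. *)
Definition area : set (measurableTypeR R * measurableTypeR R) -> \bar R :=
  (lam \x lam)%E.

HB.instance Definition _ := Measure.on area.

Let area_sigma_finite : sigma_finite setT area.
Proof.
exists (fun n => `[- n%:R, n%:R]%classic `*` `[- n%:R, n%:R]%classic).
  apply/esym; rewrite -subTset => -[x y] _.
  have [n nx] : exists n, Num.max `|x| `|y| <= n%:R.
    exists (Num.truncn (Num.max `|x| `|y|)).+1.
    by apply/ltW/Num.Theory.truncnS_gt.
  exists n => //; move: nx; rewrite ge_max !ler_norml => /andP[nx ny].
  by split; rewrite /= in_itv.
move=> n; split; first exact: measurableX.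
by rewrite /area product_measure1E//= !lebesgue_measure_itv/=; case: ifP => _;
  rewrite ?mul0e// -EFinB -EFinM ltry.
Qed.

HB.instance Definition _ :=
  @Measure_isSigmaFinite.Build _ _ _ area area_sigma_finite.

Definition vol3 : set (measurableTypeR R * measurableTypeR R * measurableTypeR R) -> \bar R :=
  (area \x lam)%E.

HB.instance Definition _ := Measure.on vol3.

Lemma volE : @vol R = vol3.
Proof. by []. Qed.

Lemma preserves_shear_fst (k c : R) :
  preserves area (fun z => (z.1 + (k * z.2 + c), z.2)).
Proof.
apply: (@preserves_fiber_fst R _ _ _ _ lam lam (fun y x => x + (k * y + c))).
  by mfun.
by move=> y; exact: preserves_shift.
Qed.

Lemma preserves_shear_snd (k c : R) :
  preserves area (fun z => (z.1, z.2 + (k * z.1 + c))).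
Proof.
apply: (@preserves_fiber_snd R _ _ _ _ lam lam (fun x y => y + (k * x + c))).
  by mfun.
by move=> y; exact: preserves_shift.
Qed.

Definition rot2 (c s : R) (z : R2) : R2 := (c * z.1 - s * z.2, s * z.1 + c * z.2).

(** A rotation is a product of three shears, unless it is the half turn, which
    is the square of a quarter turn. *)
Lemma preserves_rot2 (c s : R) : c ^+ 2 + s ^+ 2 = 1 -> preserves area (rot2 c s).
Proof.
have main c' s' : c' ^+ 2 + s' ^+ 2 = 1 -> 1 + c' != 0 ->
    preserves area (rot2 c' s').
  move=> cs c0; set t := - s' / (1 + c').
  have ss : s' ^+ 2 = 1 - c' ^+ 2 by rewrite -cs; ring.
  have ts : t * s' = c' - 1 by rewrite /t mulrAC mulNr -expr2 ss; field.
  have tc : t * c' = - s' - t by rewrite /t; field.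
  apply: eq_preserves (preserves_comp (preserves_shear_fst t 0)
    (preserves_comp (preserves_shear_snd s' 0) (preserves_shear_fst t 0))).
  move=> [x y]; rewrite /rot2 /=; congr (_, _); last by ring: ts.
  transitivity (x + 2 * (t * y) + (t * s') * x + t * (t * s') * y); first by ring.
  by rewrite ts; ring: tc.
move=> cs; have [c1|c0] := eqVneq (1 + c) 0; last exact: main.
have -> : rot2 c s = rot2 0 1 \o rot2 0 1.
  have cE : c = -1 by apply/eqP; rewrite -addr_eq0 addrC c1.
  have /eqP : s ^+ 2 = 0 by move: cs; rewrite cE => cs; lra.
  rewrite sqrf_eq0 => /eqP ->; rewrite cE.
  by apply/funext => -[x y]; rewrite /rot2 /=; congr (_, _); ring.
by apply: preserves_comp; apply: main; rewrite ?addr0 ?oner_eq0 //; ring.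
Qed.

Lemma preserves_shift2 (v : R2) : preserves area (fun z => (z.1 + v.1, z.2 + v.2)).
Proof.
apply: eq_preserves (preserves_comp (preserves_shear_fst 0 v.1)
  (preserves_shear_snd 0 v.2)).
by move=> z /=; rewrite !mul0r !add0r.
Qed.

Lemma preserves_vol_xy (f : R2 -> R2) : preserves area f ->
  preserves vol3 (fun x : R3 R => (f x.1, x.2)).
Proof.
move=> pf.
have H := @preserves_fiber_fst R _ _ _ _ area lam (fun=> f).
apply: H.
  apply: measurable_fun_pair; last exact: measurable_snd.
  by apply: measurableT_comp; [exact: pf.1 | exact: measurable_fst].
by move=> _.
Qed.

Lemma preserves_vol_shift (p : R3 R) : preserves vol3 (fun x => p + x).
Proof.
apply: (@eq_preserves R _ _ _ ((fun x : R3 R => ((x.1.1 + p.1.1, x.1.2 + p.1.2), x.2))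
  \o (fun x : R3 R => (x.1, x.2 + p.2)))).
  by move=> x /=; apply/pair_equal_spec; split;
    [apply/pair_equal_spec; split|] => /=; rewrite addrC.
apply: preserves_comp.
  exact: (preserves_vol_xy (preserves_shift2 p.1)).
apply: (@preserves_fiber_snd R _ _ _ _ area lam (fun w z => z + p.2)).
  by mfun.
by move=> _; exact: preserves_shift.
Qed.

Lemma preserves_vol_shear_y (k : R) :
  preserves vol3 (fun x : R3 R => ((x.1.1, x.1.2 + k * x.2), x.2)).
Proof.
have H := @preserves_fiber_fst R _ _ _ _ area lam
  (fun z w => (w.1 + 0, w.2 + k * z)).
apply: eq_preserves (H _ _).
- by move=> x /=; rewrite addr0.
- by mfun.
- by move=> z; exact: (preserves_shift2 (0, k * z)).
Qed.

Lemma preserves_vol_shear_z (k : R) :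
  preserves vol3 (fun x : R3 R => (x.1, x.2 + k * x.1.2)).
Proof.
have H := @preserves_fiber_snd R _ _ _ _ area lam (fun w z => z + k * w.2).
by apply: H; [mfun | move=> w; exact: preserves_shift].
Qed.

Definition rot_yz (c s : R) (x : R3 R) : R3 R :=
  ((x.1.1, c * x.1.2 - s * x.2), s * x.1.2 + c * x.2).

Lemma preserves_vol_rot_yz (c s : R) : c ^+ 2 + s ^+ 2 = 1 ->
  preserves vol3 (rot_yz c s).
Proof.
have main c' s' : c' ^+ 2 + s' ^+ 2 = 1 -> 1 + c' != 0 ->
    preserves vol3 (rot_yz c' s').
  move=> cs c0; set t := - s' / (1 + c').
  have ss : s' ^+ 2 = 1 - c' ^+ 2 by rewrite -cs; ring.
  have ts : t * s' = c' - 1 by rewrite /t mulrAC mulNr -expr2 ss; field.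
  have tc : t * c' = - s' - t by rewrite /t; field.
  apply: eq_preserves (preserves_comp (preserves_vol_shear_y t)
    (preserves_comp (preserves_vol_shear_z s') (preserves_vol_shear_y t))).
  move=> [[w x] y]; rewrite /rot_yz /=; congr (_, _, _); last by ring: ts.
  transitivity (x + 2 * (t * y) + (t * s') * x + t * (t * s') * y); first by ring.
  by rewrite ts; ring: tc.
move=> cs; have [c1|c0] := eqVneq (1 + c) 0; last exact: main.
have -> : rot_yz c s = rot_yz 0 1 \o rot_yz 0 1.
  have cE : c = -1 by apply/eqP; rewrite -addr_eq0 addrC c1.
  have /eqP : s ^+ 2 = 0 by move: cs; rewrite cE => cs; lra.
  rewrite sqrf_eq0 => /eqP ->; rewrite cE.
  by apply/funext => -[[w x] y]; rewrite /rot_yz /=; congr (_, _, _); ring.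
by apply: preserves_comp; apply: main; rewrite ?addr0 ?oner_eq0 //; ring.
Qed.

Definition frame (p a b u : R3 R) (x : R3 R) : R3 R :=
  p + x.1.1 *: a + x.1.2 *: b + x.2 *: u.

(** A rotation about the first axis followed by one about the third carries the
    third axis to [u]; each is a product of shears. *)
Lemma exists_frame (p u : R3 R) : dot u u = 1 ->
  exists a b : R3 R,
    [/\ dot a a = 1, dot b b = 1, dot a b = 0, dot a u = 0 & dot b u = 0] /\
    preserves vol3 (frame p a b u).
Proof.
case: u => -[u1 u2] c; rewrite /dot /= => uu.
pose s := Num.sqrt (u1 ^+ 2 + u2 ^+ 2).
have ss : s ^+ 2 = u1 ^+ 2 + u2 ^+ 2 by rewrite sqr_sqrtr// addr_ge0// sqr_ge0.
have [C [S [CS Cs Ss]]] : exists C S : R,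
    [/\ C ^+ 2 + S ^+ 2 = 1, C * s = u2 & - S * s = u1].
  have [s0|s0] := eqVneq s 0.
    move: ss; rewrite s0 expr0n /= => /esym/eqP.
    rewrite paddr_eq0 ?sqr_ge0// !sqrf_eq0 => /andP[/eqP-> /eqP->].
    by exists 1, 0; split; ring.
  exists (u2 / s), (- u1 / s); split; [|by field|by field].
  by rewrite !expr_div_n -mulrDl sqrrN addrC -ss divff// sqrf_eq0.
have cs : c ^+ 2 + (- s) ^+ 2 = 1 by rewrite sqrrN ss -uu; ring.
have s2 : s ^+ 2 = 1 - c ^+ 2 by rewrite -cs; ring.
have S2 : S ^+ 2 = 1 - C ^+ 2 by rewrite -CS; ring.
exists ((C, S), 0), ((- S * c, C * c), - s); split.
  rewrite /= -Cs -Ss; split; try by ring: s2 S2.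
apply: eq_preserves (preserves_comp (preserves_vol_shift p) (preserves_comp
  (preserves_vol_xy (preserves_rot2 CS)) (preserves_vol_rot_yz cs))).
move=> [[x y] z]; case: p => -[p1 p2] p3.
rewrite /frame /rot2 /rot_yz /= -!addrA; congr (_ + _).
by rewrite -Cs -Ss; congr (_, _, _) => /=;
   rewrite ?/GRing.scale /=; ring.
Qed.

End Frames.

(** * Areas of discs and of their segments, volumes of balls *)

Section Areas.
Context {R : realType}.
Local Notation lam := (@lebesgue_measure R).
Local Notation R2 := (R * R)%type.

Lemma integral_of_derivative (f F : R -> R) a b : a < b ->
  (forall x, a <= x <= b -> {for x, continuous f}) ->
  (forall x, a <= x <= b -> {for x, continuous F}) ->
  (forall x, a < x < b -> is_derive x 1 F (f x)) ->
  (\int[lam]_(x in `[a, b]) (f x)%:E)%E = (F b - F a)%:E.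
Proof.
move=> ab cf cF dF; rewrite EFinB; apply: continuous_FTC2 => //.
- by apply: continuous_in_subspaceT => x; rewrite inE/= in_itv/= => /cf.
- split.
  + by move=> x; rewrite in_itv/= => /dF [].
  + by apply: cvg_at_right_filter; apply: cF; rewrite lexx ltW.
  + by apply: cvg_at_left_filter; apply: cF; rewrite lexx ltW.
- move=> x; rewrite in_itv/= => /dF dx.
  by rewrite derive1E; apply: derive_val.
Qed.

Lemma area_sections (D : set R) (f : R -> R) (A : set R2) :
  measurable D -> measurable A ->
  (forall x, D x -> lam (xsection A x) = (f x)%:E) ->
  (forall x, ~ D x -> xsection A x = set0) ->
  area A = (\int[lam]_(x in D) (f x)%:E)%E.
Proof.
move=> mD mA fA A0; rewrite [RHS]integral_mkcond.
apply: eq_integral => x _; rewrite /= patchE.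
by case: ifPn; rewrite ?inE ?notin_setE; [exact: fA | move=> /A0 ->; rewrite measure0].
Qed.

Lemma area_sections_ge (D : set R) (f : R -> R) (A : set R2) :
  measurable D -> measurable A -> measurable_fun D f ->
  (forall x, D x -> 0 <= f x) ->
  (forall x, D x -> ((f x)%:E <= lam (xsection A x))%E) ->
  (\int[lam]_(x in D) (f x)%:E <= area A)%E.
Proof.
move=> mD mA mf f0 fA; rewrite integral_mkcond.
apply: ge0_le_integral => //.
- by move=> x _; rewrite patchE; case: ifPn; rewrite ?inE// => /f0.
- apply/(measurable_restrictT _ mD).
  exact/measurable_EFinP.
- exact: (measurable_fun_xsection lam mA).
- move=> x _; rewrite /= patchE; case: ifPn => [/set_mem|_]; first exact: fA.
  exact: measure_ge0.
Qed.

(** The half-angle [atan (sqrt (r ^ 2 - x ^ 2) / (r + x))] is continuous up to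
    [x = r], which makes it a convenient antiderivative. *)
Lemma integral_circle (a r : R) : 0 < r -> - r < a -> a < r ->
  (\int[lam]_(x in `[a, r]) (2 * Num.sqrt (r ^+ 2 - x ^+ 2))%:E)%E =
  (2 * r ^+ 2 * atan (Num.sqrt (r ^+ 2 - a ^+ 2) / (r + a))
   - a * Num.sqrt (r ^+ 2 - a ^+ 2))%:E.
Proof.
move=> r0 ra ar.
pose w x := Num.sqrt (r ^+ 2 - x ^+ 2).
pose F x := x * w x - 2 * r ^+ 2 * atan (w x / (r + x)).
have cw : continuous w.
  move=> x; apply: continuous_comp; last exact: sqrt_continuous.
  by apply: continuousB; [exact: cst_continuous | exact: exprn_continuous].
have wr : w r = 0 by rewrite /w subrr sqrtr0.
rewrite [RHS](_ : _ = (F r - F a)%:E); last first.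
  by rewrite /F wr mulr0 mul0r atan0 mulr0 subrr sub0r opprB.
apply: integral_of_derivative => //.
- by move=> x _; apply: continuousM; [exact: cst_continuous | exact: cw].
- move=> x /andP[ax xr]; apply: continuousB.
    by apply: continuousM => //; exact: cw.
  apply: continuousM; first exact: cst_continuous.
  apply: continuous_comp; last exact: continuous_atan.
  apply: continuousM; first exact: cw.
  apply: continuousV; first by rewrite gt_eqF//; lra.
  by apply: continuousD; [exact: cst_continuous |].
- move=> x /andP[ax xr].
  have w2 : 0 < r ^+ 2 - x ^+ 2 by rewrite subr_sqr mulr_gt0//; lra.
  have w0 : 0 < w x by rewrite sqrtr_gt0.
  have rx : r + x != 0 by rewrite gt_eqF//; lra.
  have ww : w x ^+ 2 = r ^+ 2 - x ^+ 2 by rewrite sqr_sqrtr// ltW.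
  have dw : is_derive x 1 w (- x / w x).
    have := @is_derive1_comp R Num.sqrt (fun x => r ^+ 2 - x ^+ 2) x _ _
      (is_derive1_sqrt w2).
    move=> /(_ (- (2 * x))) H; apply: is_derive_eq.
      apply: H; apply: is_derive_eq.
      by rewrite !scaler1 /=; ring.
    by rewrite -/(w x); field; rewrite gt_eqF.
  rewrite /F; apply: is_derive_eq.
  rewrite /GRing.scale /=.
  have q : 1 + (w x / (r + x)) ^+ 2 = 2 * r / (r + x).
    by rewrite expr_div_n ww; field.
  rewrite q -/(w x).
  have rn : r != 0 by rewrite gt_eqF.
  have wn : w x != 0 by rewrite gt_eqF.
  have w1 : w x = (r ^+ 2 - x ^+ 2) / w x by rewrite -ww expr2 mulfK.
  transitivity (w x - x ^+ 2 / w x + r * (w x ^+ 2) / ((r + x) * w x) + r * x / w x).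
    by field; rewrite ?rn ?wn ?rx.
  transitivity (w x + (r ^+ 2 - x ^+ 2) / w x); first by rewrite ww; field; rewrite ?rn ?wn ?rx.
  by rewrite -w1; ring.
Qed.

(** Open and closed discs are measured by the same proof. *)
Definition lt_or_le (b : bool) (x y : R) : bool := if b then x < y else x <= y.

Lemma measurable_lt_or_le b d (T : measurableType d) (f g : T -> R) :
  measurable_fun setT f -> measurable_fun setT g ->
  measurable [set x | lt_or_le b (f x) (g x)].
Proof. by case: b; [exact: measurable_set_lt | exact: measurable_set_le]. Qed.

Lemma measure_sqr_ball b (c : R) : lam [set y | lt_or_le b (y ^+ 2) c] =
  (2 * Num.sqrt c)%:E.
Proof.
have [c0|c0] := ltP c 0.
  rewrite (_ : [set _ | _] = set0) ?measure0 ?ltr0_sqrtr ?mulr0//.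
  apply/seteqP; split => // y /=; rewrite /lt_or_le.
  by have := sqr_ge0 y; case: b; lra.
set w := Num.sqrt c; have w0 : 0 <= w by exact: sqrtr_ge0.
have cE : c = w ^+ 2 by rewrite sqr_sqrtr.
rewrite (_ : [set _ | _] = [set` Interval (BSide (~~ b) (- w)) (BSide b w)]).
  rewrite lebesgue_measure_itv /= lte_fin.
  case: ifPn => [_|]; first by rewrite -EFinB; congr (_%:E); ring.
  by rewrite -leNgt => ww; congr (_%:E); lra.
have bE y : lt_or_le b (y ^+ 2) c = lt_or_le b `|y| w.
  rewrite /lt_or_le cE -real_normK ?num_real//.
  by case: (b); [rewrite ltr_sqr|rewrite ler_sqr]; rewrite ?nnegrE.
apply/seteqP; split => y /=; rewrite in_itv /= bE /lt_or_le;
  by case: (b); rewrite /= ?ltr_norml ?ler_norml.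
Qed.

(** The two flags tell whether the arc and the chord are left out. *)
Definition disc_cap b b' (a r : R) : set R2 :=
  [set z | lt_or_le b' a z.1 /\ lt_or_le b (z.1 ^+ 2 + z.2 ^+ 2) (r ^+ 2)].

Lemma measurable_disc_cap b b' a r : measurable (disc_cap b b' a r).
Proof. by apply: measurableI; apply: measurable_lt_or_le; mfun. Qed.

Lemma area_disc_cap b b' (a r : R) : 0 < r -> - r < a -> a < r ->
  area (disc_cap b b' a r) =
  (2 * r ^+ 2 * atan (Num.sqrt (r ^+ 2 - a ^+ 2) / (r + a))
   - a * Num.sqrt (r ^+ 2 - a ^+ 2))%:E.
Proof.
move=> r0 ra ar; rewrite -integral_circle//.
have cf : continuous (fun x : R => 2 * Num.sqrt (r ^+ 2 - x ^+ 2)).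
  move=> x; apply: cvgM; first exact: cvg_cst.
  apply: continuous_comp; last exact: sqrt_continuous.
  by apply: continuousB; [exact: cst_continuous | exact: exprn_continuous].
have mf := continuous_measurable_fun cf.
rewrite (@area_sections [set` Interval (BSide (~~ b') a) (BRight r)]
  (fun x => 2 * Num.sqrt (r ^+ 2 - x ^+ 2))) //.
- case: b' => //=; rewrite integral_itv_obnd_cbnd//.
  by apply/measurable_EFinP; exact: measurable_funTS.
- exact: measurable_disc_cap.
- move=> x /=; rewrite in_itv /= => /andP[ax xr].
  rewrite -(measure_sqr_ball b); congr (lam _); apply/seteqP; split => y;
    rewrite /xsection /= !inE /disc_cap /= {2}/lt_or_le.
    by move=> [_]; rewrite /lt_or_le; case: b; lra.
  move: ax; case: b' => /= ax; rewrite /lt_or_le; case: b => ?; split => //; lra.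
- move=> x /=; rewrite in_itv /= => /negP; rewrite negb_and => axr.
  apply/seteqP; split => // y; rewrite /xsection /= !inE /disc_cap /=.
  move=> [ax xy].
  have : x ^+ 2 <= r ^+ 2.
    have := sqr_ge0 y; move: xy; rewrite /lt_or_le.
    by case: b; lra.
  have x0 : - r < x by move: ax; clear axr; rewrite /lt_or_le; case: (b'); lra.
  have : ~~ (x <= r) by move: ax axr; rewrite /lt_or_le; case: (b') => /= ->.
  by rewrite -ltNge => rx; nra.
Qed.

Definition disc b (r : R) : set R2 := [set z | lt_or_le b (z.1 ^+ 2 + z.2 ^+ 2) (r ^+ 2)].

Lemma measurable_disc b r : measurable (disc b r).
Proof. by apply: measurable_lt_or_le; mfun. Qed.

Lemma area_disc b (r : R) : 0 <= r -> area (disc b r) = (pi * r ^+ 2)%:E.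
Proof.
rewrite le_eqVlt => /predU1P[<-|r0].
  rewrite expr0n /= mulr0; apply: integral0_eq => x _.
  rewrite /= (_ : xsection _ _ = [set y | lt_or_le b (y ^+ 2) (- x ^+ 2)]).
    by rewrite measure_sqr_ball ler0_sqrtr ?mulr0// oppr_le0 sqr_ge0.
  apply/seteqP; split => y; rewrite /xsection /= inE /disc /= expr0n /= /lt_or_le;
  by case: b; lra.
(* The two open half discs do not cover the disc: the right one is open along
   the diameter, the left one is closed there. *)
pose half b' := disc_cap b b' 0 r.
have areah b' : area (half b') = (pi * r ^+ 2 / 2)%:E.
  rewrite area_disc_cap ?oppr_lt0// expr0n /= subr0 addr0 sqrtr_sqr gtr0_norm//.
  by rewrite divff ?gt_eqF// atan1; congr (_%:E); field.
have [mrot prot] := @preserves_rot2 R (-1) 0 ltac:(ring).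
have -> : disc b r = half true `|` rot2 (-1) 0 @^-1` half false.
  apply/seteqP; split => -[x y].
    rewrite /disc /half /disc_cap /rot2 /lt_or_le /= => xy.
    by have [x0|x0] := ltP 0 x; [left|right]; split => //;
      case: (b) xy => ?; lra.
  by case; rewrite /disc /half /disc_cap /rot2 /lt_or_le /= => -[_];
    case: (b); lra.
have mh b' : measurable (half b') by exact: measurable_disc_cap.
have mh' : measurable (rot2 (-1) 0 @^-1` half false).
  exact: measurable_preimage.
have dis : half true `&` rot2 (-1) 0 @^-1` half false = set0.
  apply/seteqP; split => // -[x y]; rewrite /half /disc_cap /rot2 /lt_or_le /=.
  by move=> [[x0 _] [x1 _]]; move: x0 x1; lra.
have /= -> := measureU area (mh true) mh' dis.
rewrite areah prot ?areah; last exact: mh.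
by rewrite -EFinD; congr (_%:E); field.
Qed.

Lemma measurable_dot d (T : measurableType d) (f g : T -> R3 R) :
  measurable_fun setT f -> measurable_fun setT g ->
  measurable_fun setT (fun x => dot (f x) (g x)).
Proof.
have cp (h : T -> R3 R) : measurable_fun setT h ->
    [/\ measurable_fun setT (fun x => (h x).1.1),
        measurable_fun setT (fun x => (h x).1.2) &
        measurable_fun setT (fun x => (h x).2)].
  move=> mh.
  have m1 := measurableT_comp measurable_fst mh.
  have m2 := measurableT_comp measurable_snd mh.
  by split => //; [exact: (measurableT_comp measurable_fst m1) |
                   exact: (measurableT_comp measurable_snd m1)].
move=> /cp [f1 f2 f3] /cp [g1 g2 g3].
by apply: measurable_funD; [apply: measurable_funD|]; exact: measurable_funM.
Qed.

Lemma eballE (r : R) : 0 <= r -> eball r = [set x : R3 R | dot x x <= r ^+ 2].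
Proof.
move=> r0; have e : r = Num.sqrt (r ^+ 2) by rewrite sqrtr_sqr ger0_norm.
have h x : (Num.sqrt (dot x x) <= r) = (dot x x <= r ^+ 2).
  by rewrite {1}e ler_sqrt ?sqr_ge0.
by apply/seteqP; split => x; rewrite /eball /enorm /= h.
Qed.

Lemma measurable_eball (r : R) : 0 <= r -> measurable (eball r).
Proof.
move=> r0; rewrite eballE//; apply: measurable_set_le => //.
exact: measurable_dot.
Qed.

Lemma vol_eball (r : R) : 0 < r -> vol3 (eball r) = (4 / 3 * pi * r ^+ 3)%:E.
Proof.
move=> r0; have mb := measurable_eball (ltW r0).
rewrite /vol3 prod_measure_ysection//.
pose f (z : R) := pi * (r ^+ 2 - z ^+ 2).
pose F (z : R) := pi * (r ^+ 2 * z - z ^+ 3 / 3).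
have <- : (\int[lam]_(z in `[(- r)%R, r]) (f z)%:E)%E = (4 / 3 * pi * r ^+ 3)%:E.
  rewrite [RHS](_ : _ = (F r - F (- r))%:E); last first.
    by congr (_%:E); rewrite /F; field.
  apply: integral_of_derivative.
  - lra.
  - move=> z _; apply: cvgM; first exact: cvg_cst.
    by apply: cvgB; [exact: cvg_cst | exact: exprn_continuous].
  - move=> z _; apply: cvgM; first exact: cvg_cst.
    apply: cvgB; first by apply: cvgM; [exact: cvg_cst | exact: cvg_id].
    by apply: cvgM; [exact: exprn_continuous | exact: cvg_cst].
  - move=> z _; rewrite /F /f; apply: is_derive_eq.
    by rewrite /GRing.scale /=; field.
rewrite [RHS]integral_mkcond; apply: eq_integral => z _.
rewrite patchE; case: ifPn.
  rewrite inE /= in_itv /= => /andP[z1 z2].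
  have rz : 0 <= r ^+ 2 - z ^+ 2 by rewrite subr_sqr mulr_ge0//; lra.
  have s0 := sqrtr_ge0 (r ^+ 2 - z ^+ 2).
  rewrite /f -(sqr_sqrtr rz) -(area_disc false s0).
  congr (area _); apply/seteqP; split => -[x y]; rewrite /ysection eballE ?ltW//= inE;
    rewrite /disc /dot /lt_or_le /= sqr_sqrtr//; lra.
rewrite notin_setE /= in_itv /= => /negP; rewrite negb_and -!ltNge => zr.
rewrite (_ : ysection _ _ = set0) ?measure0//.
apply/seteqP; split => // -[x y]; rewrite /ysection eballE ?ltW//= inE /dot /=.
have := sqr_ge0 x; have := sqr_ge0 y.
have : r ^+ 2 < z ^+ 2 by case/orP: zr => ?; nra.
by rewrite !expr2; lra.
Qed.

End Areas.

(** * The two trigonometric inequalities *)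

Section Trig.
Context {R : realType}.

(** A negative value inside would make the slope negative before it and positive
    after it. *)
Lemma concave_ge0 (g g' : R -> R) (a b : R) :
  (forall x : R, is_derive x (1 : R) g (g' x)) ->
  (forall x y, a <= x -> x <= y -> y <= b -> g' y <= g' x) ->
  0 <= g a -> 0 <= g b -> forall x, a <= x <= b -> 0 <= g x.
Proof.
move=> dg mg ga gb x /andP[]; rewrite le_eqVlt => /predU1P[<-//|ax].
rewrite le_eqVlt => /predU1P[->//|xb].
have cg (u v : R) : {within `[u, v], continuous g}.
  apply: derivable_within_continuous => y _; by have [] := dg y.
have [c1 c1I e1] := MVT ax (fun y _ => dg y) (@cg _ _).
have [c2 c2I e2] := MVT xb (fun y _ => dg y) (@cg _ _).
move: c1I c2I; rewrite !in_itv /= => /andP[ac1 c1x] /andP[xc2 c2b].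
have le12 : g' c2 <= g' c1 by apply: mg; rewrite ?ltW// (lt_trans c1x).
rewrite leNgt; apply/negP => gx.
have : g' c1 < 0 by rewrite -(@pmulr_llt0 _ (x - a)) ?subr_gt0// -e1; lra.
have : 0 < g' c2 by rewrite -(@pmulr_lgt0 _ (b - x)) ?subr_gt0// -e2; lra.
by lra.
Qed.

(** The circumradius of an equilateral triangle of side [2]. *)
Definition rho : R := 2 / Num.sqrt 3.

Lemma sqrt3_sqr : (Num.sqrt 3 : R) ^+ 2 = 3.
Proof. by rewrite sqr_sqrtr. Qed.

Lemma sqrt3_gt0 : 0 < Num.sqrt 3 :> R.
Proof. by rewrite sqrtr_gt0. Qed.

Lemma sqrt3_bounds : (1732 / 1000 < Num.sqrt 3 :> R) && (Num.sqrt 3 < 17321 / 10000 :> R).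
Proof. by have := sqrt3_gt0; have := sqrt3_sqr => s2 s0; apply/andP; split; nra. Qed.

Lemma rho_sqr : rho ^+ 2 = 4 / 3.
Proof. by rewrite /rho expr_div_n sqrt3_sqr; field. Qed.

Lemma rho_gt0 : 0 < rho.
Proof. by rewrite divr_gt0// sqrt3_gt0. Qed.

Lemma rho_sqrt3 : rho * Num.sqrt 3 = 2.
Proof. by rewrite /rho divfK// gt_eqF// sqrt3_gt0. Qed.

Lemma rhoE : rho = 2 * Num.sqrt 3 / 3.
Proof.
apply: (mulIf (lt0r_neq0 sqrt3_gt0)); rewrite rho_sqrt3.
transitivity (2 * Num.sqrt 3 ^+ 2 / 3 : R); first by rewrite sqrt3_sqr; field.
by field.
Qed.

Lemma pi6_bounds : 0 < (pi / 6 : R) < (pi / 2 : R).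
Proof. by have := pi_gt0 R; lra. Qed.

Lemma sin_pi6 : sin (pi / 6) = 1 / 2 :> R.
Proof.
have s0 : 0 < sin (pi / 6 : R) by apply: sin_gt0_pihalf; exact: pi6_bounds.
have : sin (pi / 6 : R) = cos (pi / 6 *+ 2).
  by rewrite -cosBpihalf -cosN; congr cos; rewrite mulr2n; field.
rewrite cos_mulr2n cos2sin2 mulr2n => e.
have : (2 * sin (pi / 6 : R) - 1) * (sin (pi / 6 : R) + 1) = 0.
  rewrite expr2 in e; move: e; set u := sin _ => e; lra.
by move/eqP; rewrite mulf_eq0 => /orP[|] /eqP; lra.
Qed.

(** The slope [3 / pi] of the chord of the sine over [[0, pi / 6]] is a value of
    the cosine. *)
Lemma pi_ge3 : 3 <= pi :> R.
Proof.
have p0 := pi_gt0 R.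
have p6 : 0 < pi / 6 :> R by rewrite divr_gt0.
have cs : {within `[0, pi / 6 : R], continuous sin}.
  by apply: continuous_subspaceT; exact: continuous_sin.
have [x _] := MVT p6 (fun x _ => is_derive_sin x) cs.
rewrite sin0 sin_pi6 !subr0; move: p6; set q := pi / 6 => q0.
have := cos_le1 x => c1 e.
have : cos x * q <= q by rewrite ger_pMl.
by rewrite -e /q; lra.
Qed.

Lemma cos_pi6 : cos (pi / 6) = Num.sqrt 3 / 2 :> R.
Proof.
have c0 : 0 < cos (pi / 6 : R).
  by apply: cos_gt0_pihalf; have := pi6_bounds; lra.
have := cos2Dsin2 (pi / 6 : R); rewrite sin_pi6 => e.
have : (cos (pi / 6 : R) - Num.sqrt 3 / 2) * (cos (pi / 6 : R) + Num.sqrt 3 / 2) = 0.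
  by have := sqrt3_sqr; rewrite !expr2 => s2; move: e; rewrite !expr2; lra.
have := sqrt3_gt0.
by move=> s0 /eqP; rewrite mulf_eq0 => /orP[|] /eqP; lra.
Qed.

Lemma sin_pi4 : sin (pi / 4) = cos (pi / 4) :> R.
Proof. by rewrite -cosBpihalf -cosN; congr cos; field. Qed.

Lemma cos_pi4_sqr : cos (pi / 4) ^+ 2 = 1 / 2 :> R.
Proof. by have := cos2Dsin2 (pi / 4 : R); rewrite sin_pi4; lra. Qed.

Lemma cos_pi4_gt0 : 0 < cos (pi / 4) :> R.
Proof. by apply: cos_gt0_pihalf; have := pi_gt0 R; lra. Qed.

Lemma cos_pi4_ge : 7071 / 10000 < cos (pi / 4) :> R.
Proof. by have := cos_pi4_gt0; have := cos_pi4_sqr => e; nra. Qed.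

Let cancel_pi (a b c : R) : a / b = c -> a / pi * (pi / b) = c.
Proof.
have := pi_gt0 R; move: (pi : R) => p p0 <-.
by rewrite mulrA divfK// gt_eqF.
Qed.

Lemma ler_cos_pi (y z : R) : 0 <= y -> y <= z -> z <= pi -> cos z <= cos y.
Proof.
rewrite [y <= z]le_eqVlt => y0 /predU1P[->//|yz] zpi.
by rewrite ltW// ltr_cos// in_itv/= ?y0 ?zpi ?andbT ?(le_trans y0 (ltW yz)) ?(le_trans (ltW yz) zpi).
Qed.

(** Since [sin x * cos x] is half of [sin (2 * x)], this is the concavity of the
    sine on [[0, pi / 3]]; equality holds at both ends. *)
Lemma chord_trig (x : R) : 0 <= x <= pi / 6 ->
  2 * Num.sqrt 3 / pi * x <= 4 / 3 * (sin x * cos x).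
Proof.
move=> x06; have p0 := pi_gt0 R.
pose k : R := 2 * Num.sqrt 3 / pi.
pose g (x : R) := 4 / 3 * (sin x * cos x) - k * x.
pose g' (x : R) := 4 / 3 * (2 * cos x ^+ 2 - 1) - k.
rewrite -subr_ge0 -/(g x); apply: (@concave_ge0 g g' 0 (pi / 6)) => //.
- move=> y; rewrite /g /g'; apply: is_derive_eq.
  by rewrite /GRing.scale /=; have := cos2Dsin2 y; lra.
- move=> y z y0 yz z6; rewrite /g'.
  have c01 (u : R) : 0 <= u -> u <= pi / 6 -> 0 <= cos u.
    by move=> u0 u6; apply: cos_ge0_pihalf; lra.
  have := c01 _ y0 (le_trans yz z6); have := c01 _ (le_trans y0 yz) z6.
  have : cos z <= cos y by apply: ler_cos_pi => //; lra.
  by rewrite !expr2; nra.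
- by rewrite /g sin0 mul0r !mulr0 subrr.
- rewrite /g sin_pi6 cos_pi6 /k.
  have -> : 2 * Num.sqrt 3 / pi * (pi / 6) = Num.sqrt 3 / 3 :> R.
    by apply: cancel_pi; clear; lra.
  by lra.
Qed.

(** The difference of the sides is concave. It vanishes at [pi / 6], and at
    [pi / 4] it is nonnegative because [9 / 4 + sqrt 3 / 3 <= 2 * sqrt 2], which
    is tight to one part in two thousand. *)
Lemma parabola_trig (x : R) : pi / 6 <= x <= pi / 4 ->
  2 * Num.sqrt 3 / pi * x <= rho / 3 * (sin x * (4 - rho * cos x)).
Proof.
move=> x64; have p0 := pi_gt0 R.
have s0 := sqrt3_gt0; have s2 := sqrt3_sqr; have rs := rho_sqrt3.
have r0 := rho_gt0; have r2 := rho_sqr; have /andP[s3 s4] := sqrt3_bounds.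
pose k : R := 2 * Num.sqrt 3 / pi.
pose g (x : R) := rho / 3 * (sin x * (4 - rho * cos x)) - k * x.
pose g' (x : R) := rho / 3 * (4 * cos x - rho * (2 * cos x ^+ 2 - 1)) - k.
rewrite -subr_ge0 -/(g x); apply: (@concave_ge0 g g' (pi / 6) (pi / 4)) => //.
- move=> y; rewrite /g /g'; apply: is_derive_eq.
  rewrite /GRing.scale /=.
  have -> : cos y ^+ 2 = 1 - sin y ^+ 2 by rewrite cos2sin2.
  have e : cos y * cos y = 1 - sin y * sin y by rewrite -!expr2 cos2sin2.
  transitivity (rho / 3 * (sin y * (rho * sin y) + 4 * cos y - rho * (cos y * cos y)) - k).
    by ring.
  by rewrite e; ring.
- have cmon (y z : R) : pi / 6 <= y -> y <= z -> z <= pi / 4 -> cos z <= cos y.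
    by move=> y0 yz z6; apply: ler_cos_pi => //; clear -p0 y0 z6; lra.
  have c01 (u : R) : pi / 6 <= u -> u <= pi / 4 -> rho * cos u <= 1.
    move=> u0 u6; have := cmon (pi / 6) u (lexx _) u0 u6.
    by rewrite cos_pi6; clear -rs r0; nra.
  move=> y z y0 yz z6; rewrite /g' lerD2r ler_pM2l ?divr_gt0//.
  have := c01 _ y0 (le_trans yz z6); have := c01 _ (le_trans y0 yz) z6.
  have := cmon _ _ y0 yz z6.
  set c1 := cos y; set c2 := cos z => c21 h2 h1.
  rewrite -subr_ge0.
  have -> : 4 * c1 - rho * (2 * c1 ^+ 2 - 1) - (4 * c2 - rho * (2 * c2 ^+ 2 - 1)) =
    2 * ((c1 - c2) * (2 - rho * c1 - rho * c2)) by ring.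
  by clear -c21 h1 h2; rewrite mulr_ge0// mulr_ge0//; lra.
- rewrite /g sin_pi6 cos_pi6 /k.
  have -> : 2 * Num.sqrt 3 / pi * (pi / 6) = Num.sqrt 3 / 3 :> R.
    by apply: cancel_pi; clear; lra.
  rewrite (mulrA rho (Num.sqrt 3)) rs rhoE; clear; lra.
- rewrite /g sin_pi4 /k.
  have -> : 2 * Num.sqrt 3 / pi * (pi / 4) = Num.sqrt 3 / 2 :> R.
    by apply: cancel_pi; clear; lra.
  have := cos_pi4_sqr; have := cos_pi4_ge; set c := cos _ => c1 c2.
  have -> : rho / 3 * (c * (4 - rho * c)) - Num.sqrt 3 / 2 =
      (Num.sqrt 3 * (16 * c - 9) - 4) / 18.
    have -> : rho = 2 * Num.sqrt 3 / 3 by exact: rhoE.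
    transitivity (8 / 9 * Num.sqrt 3 * c - 4 / 27 * Num.sqrt 3 ^+ 2 * c ^+ 2
       - Num.sqrt 3 / 2); first by field.
    by rewrite s2 c2; field.
  by clear -s3 c1; rewrite divr_ge0//; nra.
Qed.

End Trig.

(** * A wedge cut by a parabola *)

Section Wedge.
Context {R : realType}.
Local Notation lam := (@lebesgue_measure R).
Local Notation R2 := (R * R)%type.

(** Twice the signed area of the triangle with vertices [0], [a] and [b]. *)
Definition cross (a b : R2) : R := a.1 * b.2 - a.2 * b.1.

Definition sqn (a : R2) : R := a.1 ^+ 2 + a.2 ^+ 2.

Definition wedge (a b : R2) : set R2 := [set v | 0 < cross a v /\ 0 < cross v b].

Definition odisc (r : R) : set R2 := [set v | sqn v < r ^+ 2].

Lemma measurable_cross (f g : R2 -> R2) :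
  measurable_fun setT f -> measurable_fun setT g ->
  measurable_fun setT (fun v => cross (f v) (g v)).
Proof.
move=> mf mg.
have f1 := measurableT_comp measurable_fst mf.
have f2 := measurableT_comp measurable_snd mf.
have g1 := measurableT_comp measurable_fst mg.
have g2 := measurableT_comp measurable_snd mg.
by apply: measurable_funB; exact: measurable_funM.
Qed.

Lemma measurable_wedge a b : measurable (wedge a b).
Proof.
by apply: measurableI; apply: measurable_set_lt; try exact: measurable_cst;
  apply: measurable_cross => //; exact: measurable_cst.
Qed.

Lemma measurable_odisc r : measurable (odisc r).
Proof. by apply: measurable_set_lt; rewrite /sqn; mfun. Qed.

Definition dot2 (a b : R2) : R := a.1 * b.1 + a.2 * b.2.

(** A quadratic function whose zero set is a parabola (or degenerate): its
    quadratic part is the square of a linear form. *)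
Definition para (l m : R2) (c : R) (v : R2) : R := dot2 l v ^+ 2 + dot2 m v - c.

Lemma measurable_para l m c : measurable_fun setT (para l m c).
Proof.
have md a : measurable_fun setT (dot2 a).
  by apply: measurable_funD; apply: measurable_funM; mfun.
apply: measurable_funB; last exact: measurable_cst.
by apply: measurable_funD => //; exact: measurable_funX.
Qed.

Section Sector.
Variables (x0 y0 : R).
Hypotheses (y00 : 0 < y0) (x00 : 0 < x0) (xy0 : x0 ^+ 2 + y0 ^+ 2 = (rho : R) ^+ 2).
Let A : R2 := (x0, - y0).
Let B : R2 := (x0, y0).

Let x0n : x0 != 0. Proof. by rewrite gt_eqF. Qed.
Let y0n : y0 != 0. Proof. by rewrite gt_eqF. Qed.

Let wedgeE (v : R2) : wedge A B v <-> [/\ 0 < v.1, - (y0 * v.1) < x0 * v.2 & x0 * v.2 < y0 * v.1].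
Proof.
rewrite /wedge /cross /A /B /=; split; last by case; lra.
move=> [h1 h2]; have h : 0 < y0 * v.1 by lra.
by rewrite -(pmulr_rgt0 _ y00); split; lra.
Qed.

(** The open triangle [0 A B]. *)
Let tri : set R2 := [set v | v.1 < x0] `&` wedge A B.

Let measurable_tri : measurable tri.
Proof.
by apply: measurableI; [apply: measurable_set_lt; mfun | exact: measurable_wedge].
Qed.

Let x0rho : x0 < rho.
Proof.
by rewrite -ltr_sqr ?nnegrE ?ltW ?rho_gt0// -xy0 ltrDl exprn_gt0.
Qed.

Let area_tri : area tri = (x0 * y0)%:E.
Proof.
pose k := 2 * (y0 / x0).
have kx : k * x0 = 2 * y0 by rewrite /k -mulrA divfK// gt_eqF.
have ck : continuous (fun x : R => k * x).
  by move=> x; apply: cvgM; [exact: cvg_cst | exact: cvg_id].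
have mk := continuous_measurable_fun ck.
rewrite (@area_sections R `]0, x0[%classic (fun x => k * x))//.
- rewrite -(@integral_itv_bndoo R 0 x0 _ true false) => //; last first.
    by apply/measurable_EFinP; exact: measurable_funTS.
  rewrite (_ : x0 * y0 = (k / 2 * x0 ^+ 2) - (k / 2 * 0 ^+ 2)); last first.
    by rewrite expr2 mulrA [k / 2 * x0]mulrAC kx expr0n /= mulr0; field.
  apply: (@integral_of_derivative R (fun x => k * x) (fun x => k / 2 * x ^+ 2)) => //.
    by move=> x _; exact: ck.
    by move=> x _; apply: cvgM; [exact: cvg_cst | exact: exprn_continuous].
  by move=> x _; apply: is_derive_eq; rewrite /GRing.scale /=; field.
- move=> x /=; rewrite in_itv /= => /andP[x1 x2].
  have h : 0 < y0 / x0 * x by rewrite mulr_gt0// divr_gt0.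
  have e : x0 * (y0 / x0 * x) = y0 * x by rewrite !mulrA [x0 * y0]mulrC mulfK// gt_eqF.
  transitivity (lam `](- (y0 / x0 * x)), (y0 / x0 * x)[%classic); last first.
    rewrite lebesgue_measure_itv /= lte_fin ifT; last lra.
    by rewrite -EFinB; congr (_%:E); rewrite /k; lra.
  congr (lam _); apply/seteqP; split => y; rewrite /xsection /= in_itv /= inE.
    move=> [_ /wedgeE /= [_ h1 h2]].
    by rewrite -(ltr_pM2l x00) mulrN e h1 -(ltr_pM2l x00) e h2.
  move=> /andP[h1 h2]; split => //=; apply/wedgeE => /=.
  by rewrite -e -mulrN !(ltr_pM2l x00).
- move=> x /=; rewrite in_itv /= => xn.
  apply/seteqP; split => // y; rewrite /xsection /= !inE => -[/= xx /wedgeE [/= x1 _ _]].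
  by apply: xn; rewrite x1 xx.
Qed.

Definition sector : set R2 := wedge A B `&` odisc rho.

Lemma measurable_sector : measurable sector.
Proof. by apply: measurableI; [exact: measurable_wedge | exact: measurable_odisc]. Qed.

Let tri_sector : tri `<=` sector.
Proof.
move=> v [/= vx /[dup] w /wedgeE [v0 h1 h2]]; split => //.
rewrite /odisc /= /sqn -xy0.
have : (x0 * v.2) ^+ 2 < (y0 * v.1) ^+ 2.
  by rewrite -subr_gt0 subr_sqr mulr_gt0//; lra.
have : (y0 * v.1) ^+ 2 < (y0 * x0) ^+ 2.
  by rewrite ltr_sqr ?nnegrE ?mulr_ge0 ?ltW// ltr_pM2l.
rewrite [in X in _ < X -> _]exprMn [(x0 * v.2) ^+ 2]exprMn => h3 h4.
have : v.2 ^+ 2 < y0 ^+ 2.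
  rewrite -(ltr_pM2l (exprn_gt0 2 x00)); lra.
have : v.1 ^+ 2 < x0 ^+ 2 by rewrite ltr_sqr ?nnegrE ?ltW.
by lra.
Qed.

Lemma area_sector : area sector = (2 * rho ^+ 2 * atan (y0 / (rho + x0)))%:E.
Proof.
pose cap := @disc_cap R true false x0 rho.
have mc : measurable cap by exact: measurable_disc_cap.
have capE : area cap = (2 * rho ^+ 2 * atan (y0 / (rho + x0)) - x0 * y0)%:E.
  have r0 := @rho_gt0 R.
  rewrite area_disc_cap//; last by rewrite (lt_trans _ x00)// oppr_lt0.
  by rewrite -xy0 [x0 ^+ 2 + _]addrC addrK sqrtr_sqr gtr0_norm.
have -> : sector = tri `|` cap.
  apply/seteqP; split => v; last first.
    move=> [/tri_sector//|[/= xv dv]]; split; last by [].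
    have {}xv : x0 <= v.1 := xv.
    have {}dv : v.1 ^+ 2 + v.2 ^+ 2 < rho ^+ 2 := dv.
    have v0 : 0 < v.1 by exact: lt_le_trans xv.
    have h : (x0 * v.2) ^+ 2 < (y0 * v.1) ^+ 2.
      have x2 : x0 ^+ 2 <= v.1 ^+ 2 by rewrite ler_sqr ?nnegrE ?(ltW x00) ?(ltW v0).
      have e : (y0 * v.1) ^+ 2 - (x0 * v.2) ^+ 2 =
        rho ^+ 2 * (v.1 ^+ 2 - x0 ^+ 2) + x0 ^+ 2 * (rho ^+ 2 - (v.1 ^+ 2 + v.2 ^+ 2)).
        by rewrite -xy0; ring.
      rewrite -subr_gt0 e ltr_wpDl//.
        by apply: mulr_ge0; [exact: sqr_ge0 | rewrite subr_ge0].
      by apply: mulr_gt0; [exact: exprn_gt0 | rewrite subr_gt0; exact: dv].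
    move: h; rewrite -[(x0 * v.2) ^+ 2]real_normK ?num_real// ltr_sqr ?nnegrE// ?mulr_ge0 ?ltW//.
    by rewrite ltr_norml => /andP[h1 h2]; apply/wedgeE; split.
  move=> [w d]; have [vx|vx] := ltP v.1 x0; first by left.
  by right.
rewrite (_ : _ * atan _ = (x0 * y0) + (2 * rho ^+ 2 * atan (y0 / (rho + x0)) - x0 * y0)); last by ring.
have dis : tri `&` cap = set0.
  apply/seteqP; split => // v [[/= h _] [/= h' _]].
  by move: h'; rewrite /lt_or_le; lra.
have /= -> := measureU area measurable_tri mc dis.
by rewrite area_tri capE.
Qed.

(** ** The region below the parabola *)

Variables (l m : R2) (c : R).
Local Notation Q := (para l m c).
Hypotheses (c0 : 0 < c) (Qunit : forall v, sqn v <= 1 -> Q v <= 0)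
  (QA : Q A = 0) (QB : Q B = 0)
  (Qarc : forall v, wedge A B v -> sqn v = rho ^+ 2 -> 0 < Q v).

Definition below : set R2 := [set v | Q v < 0].

Let measurable_below : measurable below.
Proof. by apply: measurable_set_lt; [exact: measurable_para | exact: measurable_cst]. Qed.

(** [Q] is convex, negative at the origin, and zero at [A] and [B]. *)
Let tri_below : tri `<=` below.
Proof.
move=> v [/= vx /wedgeE [v0 h1 h2]].
pose a := (v.1 / x0 - v.2 / y0) / 2; pose b := (v.1 / x0 + v.2 / y0) / 2.
have ab : a + b = v.1 / x0 by rewrite /a /b; field; rewrite ?x0n ?y0n.
have v1E : v.1 = x0 * (a + b) by rewrite ab mulrC divfK// gt_eqF.
have v2E : v.2 = y0 * (b - a).
  by rewrite /a /b; field; rewrite ?x0n ?y0n.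
have xy : 0 < x0 * y0 by rewrite mulr_gt0.
have a0 : 0 < a.
  have e : x0 * y0 * a = (y0 * v.1 - x0 * v.2) / 2.
    by rewrite /a; field; rewrite ?x0n ?y0n.
  by rewrite -(pmulr_rgt0 _ xy) e; lra.
have b0 : 0 < b.
  have e : x0 * y0 * b = (y0 * v.1 + x0 * v.2) / 2.
    by rewrite /b; field; rewrite ?x0n ?y0n.
  by rewrite -(pmulr_rgt0 _ xy) e; lra.
have ab1 : a + b < 1 by rewrite ab ltr_pdivrMr// mul1r.
move: QA QB; rewrite /below /para /dot2 /A /B /= v1E v2E.
set LA := l.1 * x0 + l.2 * - y0; set LB := l.1 * x0 + l.2 * y0.
set MA := m.1 * x0 + m.2 * - y0; set MB := m.1 * x0 + m.2 * y0 => eA eB.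
have -> : l.1 * (x0 * (a + b)) + l.2 * (y0 * (b - a)) = a * LA + b * LB.
  by rewrite /LA /LB; ring.
have -> : m.1 * (x0 * (a + b)) + m.2 * (y0 * (b - a)) = a * MA + b * MB.
  by rewrite /MA /MB; ring.
have -> : MA = c - LA ^+ 2 by lra.
have -> : MB = c - LB ^+ 2 by lra.
rewrite (_ : _ - c = - (a * b * (LA - LB) ^+ 2)
   - (1 - (a + b)) * (a * LA ^+ 2 + b * LB ^+ 2) - (1 - (a + b)) * c); last by ring.
have h3 : 0 <= a * b * (LA - LB) ^+ 2 by rewrite mulr_ge0 ?sqr_ge0// mulr_ge0// ltW.
have h4 : 0 <= (1 - (a + b)) * (a * LA ^+ 2 + b * LB ^+ 2).
  apply: mulr_ge0; first lra.
  by apply: addr_ge0; apply: mulr_ge0; rewrite ?sqr_ge0 ?(ltW a0) ?(ltW b0).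
have h5 : 0 < (1 - (a + b)) * c by rewrite mulr_gt0//; lra.
by lra.
Qed.

(** Convexity between the origin, where [Q] is [- c], and [v]. Consequently [Q]
    increases strictly along a ray once it is nonnegative. *)
Lemma para_scale (t : R) v : 0 <= t <= 1 ->
  Q (t * v.1, t * v.2) <= t * Q v - (1 - t) * c.
Proof.
move=> t01; rewrite /para /dot2 /=.
rewrite (_ : l.1 * (t * v.1) + l.2 * (t * v.2) = t * (l.1 * v.1 + l.2 * v.2)); last by ring.
rewrite (_ : m.1 * (t * v.1) + m.2 * (t * v.2) = t * (m.1 * v.1 + m.2 * v.2)); last by ring.
set L := l.1 * _ + _; set M := m.1 * _ + _.
rewrite -subr_ge0 (_ : _ - _ = t * (1 - t) * L ^+ 2); last by ring.
by apply: mulr_ge0; [apply: mulr_ge0; lra | exact: sqr_ge0].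
Qed.

Let segment : set R2 := [set v | x0 <= v.1 /\ v.1 < 1] `&` below.

Let measurable_segment : measurable segment.
Proof.
apply: measurableI => //; apply: measurableI.
  by apply: measurable_set_le; mfun.
by apply: measurable_set_lt; mfun.
Qed.

(** On a vertical line between the chord [A B] and the tangent [x = 1] of the
    unit disc, [Q <= 0] at the horizontal axis and [Q >= 0] on the two rays
    bounding the wedge; so the interval where [Q < 0] lies in the wedge. *)
Let segment_sector : segment `<=` sector.
Proof.
move=> [x y] [[/= xx0 x1] Qv].
have x0' : 0 < x by exact: lt_le_trans xx0.
have Qx : Q (x, 0) <= 0.
  by apply: Qunit; rewrite /sqn /= expr0n /= addr0 expr_le1// ltW.
have ray (s : R) : Q (x0, s * y0) = 0 -> s ^+ 2 = 1 -> 0 <= Q (x, s * (y0 * x / x0)).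
  move=> Qs s1.
  pose t := x0 / x; have t01 : 0 <= t <= 1.
    by rewrite /t divr_ge0 ?(ltW x00) ?(ltW x0')//= ler_pdivrMr// mul1r.
  have tt : t * x = x0 by rewrite /t divfK// gt_eqF.
  have := para_scale (x, s * (y0 * x / x0)) t01.
  rewrite /= tt (_ : t * _ = s * y0); last by rewrite /t; field; rewrite ?x0n ?gt_eqF.
  rewrite Qs => h.
  have t0 : 0 < t by rewrite divr_gt0.
  rewrite -(pmulr_rge0 _ t0); have : 0 <= (1 - t) * c by apply: mulr_ge0; [lra | exact: ltW].
  by lra.
have side (s : R) : Q (x0, s * y0) = 0 -> s ^+ 2 = 1 -> x0 * (s * y) < y0 * x.
  move=> Qs s1; rewrite ltNge; apply/negP => h.
  have sy : 0 < s * y.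
    by rewrite -(pmulr_rgt0 _ x00) (lt_le_trans _ h)// mulr_gt0.
  pose u := y0 * x / x0 / (s * y).
  have u0 : 0 < u by rewrite !(mulr_gt0, divr_gt0) ?invr_gt0.
  have u1 : u <= 1 by rewrite /u ler_pdivrMr// mul1r ler_pdivrMr// [_ * x0]mulrC.
  have := ray s Qs s1.
  have -> : s * (y0 * x / x0) = u * y.
    have ys : y = s * (s * y) by rewrite mulrA -expr2 s1 mul1r.
    by rewrite [in RHS]ys [RHS]mulrCA /u divfK// gt_eqF.
  have Qc : Q (x, u * y) <= u * Q (x, y) + (1 - u) * Q (x, 0).
    rewrite /para /dot2 /= -subr_ge0.
    rewrite (_ : _ - _ = u * (1 - u) * (l.2 * y) ^+ 2); last by ring.
    by apply: mulr_ge0; [apply: mulr_ge0; lra | exact: sqr_ge0].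
  have : u * Q (x, y) < 0 by rewrite pmulr_rlt0.
  have : (1 - u) * Q (x, 0) <= 0 by rewrite mulr_ge0_le0//; lra.
  by lra.
have w : wedge A B (x, y).
  apply/wedgeE; split => //=.
    have := side (-1); rewrite !mulN1r sqrrN expr1n => /(_ QA erefl).
    by lra.
  by have := side 1; rewrite !mul1r ?expr1n => /(_ QB erefl).
split => //; rewrite /odisc /= ltNge; apply/negP => dv.
have s0 : 0 < sqn (x, y) by exact: lt_le_trans (exprn_gt0 2 rho_gt0) dv.
pose n := Num.sqrt (sqn (x, y)); have n0 : 0 < n by rewrite sqrtr_gt0.
have nn : n ^+ 2 = sqn (x, y) by rewrite sqr_sqrtr// ltW.
have rho0 := @rho_gt0 R.
have rn : rho <= n by rewrite -ler_sqr ?nnegrE ?(ltW n0) ?(ltW rho0)// nn.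
pose t := rho / n.
have t01 : 0 <= t <= 1.
  by rewrite /t divr_ge0 ?(ltW n0) ?(ltW rho0)//= ler_pdivrMr// mul1r.
have t0 : 0 < t by rewrite divr_gt0.
have := para_scale (x, y) t01; rewrite /=.
have : 0 < Q (t * x, t * y).
  apply: Qarc.
    move/wedgeE : w => /= [_ w1 w2]; apply/wedgeE; split => /=.
    - by rewrite mulr_gt0.
    - by rewrite -subr_gt0 (_ : _ - _ = t * (x0 * y + y0 * x)); [rewrite mulr_gt0//; lra | ring].
    - by rewrite -subr_gt0 (_ : _ - _ = t * (y0 * x - x0 * y)); [rewrite mulr_gt0//; lra | ring].
  transitivity ((t * n) ^+ 2); first by rewrite exprMn nn /sqn /=; ring.
  by congr (_ ^+ 2); rewrite /t divfK// gt_eqF.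
have : t * Q (x, y) < 0 by rewrite pmulr_rlt0.
have : 0 <= (1 - t) * c by apply: mulr_ge0; [lra | exact: ltW].
by lra.
Qed.

(** On the vertical line at [x], the set [Q < 0] is an interval whose squared
    half-length is affine in [x]. It is [y0 ^ 2] at [x0], and nonnegative at [1]
    because [Q <= 0] at the point [(1, 0)] of the unit disc. *)
Let area_segment : x0 < 1 ->
  ((4 / 3 * y0 * (1 - x0))%:E <= area segment)%E.
Proof.
move=> x01; have [k kE] : exists k, k = l.2 ^+ 2 by exists (l.2 ^+ 2).
have l2 : l.2 != 0.
  apply/eqP => l20; have mm : m.2 = 0.
    apply: (mulIf y0n); rewrite mul0r.
    by move: QA QB; rewrite /para /dot2 /A /B /= l20; lra.
  have x01' : 0 <= x0 <= 1 by rewrite (ltW x00) (ltW x01).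
  have := para_scale (1, 0) x01'; rewrite /=.
  have -> : Q (x0 * 1, x0 * 0) = 0 by rewrite -QB /para /dot2 /B /= l20 mm; ring.
  have Q1 : Q (1, 0) <= 0.
    by apply: Qunit; rewrite /sqn /= expr1n expr0n /= addr0.
  have : x0 * Q (1, 0) <= 0 by rewrite mulr_ge0_le0// ltW.
  have : 0 < (1 - x0) * c by rewrite mulr_gt0//; lra.
  by lra.
have k0 : 0 < k by rewrite kE exprn_even_gt0.
pose f x : R := 2 * (y0 * Num.sqrt ((1 - x) / (1 - x0))).
have cs : continuous (fun x : R => Num.sqrt ((1 - x) / (1 - x0))).
  move=> x; apply: continuous_comp; last exact: sqrt_continuous.
  apply: cvgM; last exact: cvg_cst.
  by apply: cvgB; [exact: cvg_cst | exact: cvg_id].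
have cf : continuous f.
  move=> x; apply: cvgM; first exact: cvg_cst.
  by apply: cvgM; [exact: cvg_cst | exact: cs].
have mf := continuous_measurable_fun cf.
have nx : 1 - x0 != 0 by rewrite subr_eq0 gt_eqF.
apply: (@le_trans _ _ (\int[lam]_(x in `[x0, 1%R[) (f x)%:E)%E).
  rewrite integral_itv_bndo_bndc; last first.
    by apply/measurable_EFinP; exact: measurable_funTS.
  pose s (x : R) := Num.sqrt ((1 - x) / (1 - x0)).
  pose F (x : R) := - (4 / 3) * y0 * (1 - x0) * ((1 - x) / (1 - x0)) * s x.
  have cF (x : R) : x0 <= x <= 1 -> {for x, continuous F}.
    move=> _; apply: cvgM; last exact: cs.
    apply: cvgM; first exact: cvg_cst.
    apply: cvgM; last exact: cvg_cst.
    by apply: cvgB; [exact: cvg_cst | exact: cvg_id].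
  have dF (x : R) : x0 < x < 1 -> is_derive x 1 F (f x).
    move=> /andP[xx0 x1].
    have q0 : 0 < (1 - x) / (1 - x0) by rewrite divr_gt0// subr_gt0.
    have s0 : 0 < s x by rewrite sqrtr_gt0.
    have ss : s x ^+ 2 = (1 - x) / (1 - x0) by rewrite sqr_sqrtr// ltW.
    have ds : is_derive x 1 s (- (1 - x0)^-1 / (2 * s x)).
      have := @is_derive1_comp R Num.sqrt (fun x => (1 - x) / (1 - x0)) x _ _
        (is_derive1_sqrt q0).
      move=> /(_ (- (1 - x0)^-1)) H; apply: is_derive_eq.
        apply: H; apply: is_derive_eq.
        by rewrite /GRing.scale /=; field.
      by rewrite -/(s x) /GRing.scale /= mulrC.
    rewrite /F; apply: is_derive_eq.
    rewrite /GRing.scale /= -ss /f -/(s x).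
    by field; rewrite nx gt_eqF.
  rewrite (integral_of_derivative x01 (fun x _ => cf x) cF dF).
  rewrite /F /s subrr mul0r sqrtr0 divff// sqrtr1 lee_fin.
  by rewrite le_eqVlt; apply/orP; left; apply/eqP; ring.
apply: area_sections_ge => //.
- exact: measurable_funTS.
- by move=> x _; rewrite /f !mulr_ge0 ?sqrtr_ge0 ?(ltW y00).
move=> x /=; rewrite in_itv /= => /andP[xx0 x1].
(* The discriminant of [Q (x, _)] is affine in [x]. *)
pose E (x : R) := (l.1 * l.2 * m.2 - k * m.1) * x + m.2 ^+ 2 / 4 + k * c.
pose h (x : R) := (l.1 * l.2 * x + m.2 / 2) / k.
have QE (u y : R) : k * Q (u, y) = k ^+ 2 * (y + h u) ^+ 2 - E u.
  rewrite /para /dot2 /= /E /h.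
  rewrite (_ : k ^+ 2 * _ = (k * y + (l.1 * l.2 * u + m.2 / 2)) ^+ 2); last first.
    by field; rewrite gt_eqF.
  by rewrite kE; field.
have hx0 : h x0 = 0.
  have := QE x0 y0; rewrite -/B QB mulr0.
  have := QE x0 (- y0); rewrite -/A QA mulr0 => e1 e2.
  have : k ^+ 2 * (4 * y0) * h x0 = 0.
    by transitivity (k ^+ 2 * (y0 + h x0) ^+ 2 - k ^+ 2 * (- y0 + h x0) ^+ 2); [ring | lra].
  move/eqP; rewrite mulf_eq0 => /orP[|/eqP//].
  have : 0 < k ^+ 2 * (4 * y0).
    have k2 : 0 < k ^+ 2 by exact: exprn_gt0.
    by apply: (mulr_gt0 k2); exact: mulr_gt0.
  by move=> /gt_eqF ->.
have Ex0 : E x0 = k ^+ 2 * y0 ^+ 2.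
  by have := QE x0 y0; rewrite -/B QB mulr0 hx0 addr0; lra.
have E1 : 0 <= E 1.
  have Q1 : Q (1, 0) <= 0.
    by apply: Qunit; rewrite /sqn /= expr1n expr0n /= addr0.
  have := QE 1 0; have : k * Q (1, 0) <= 0 by rewrite pmulr_rle0.
  have : 0 <= k ^+ 2 * (0 + h 1) ^+ 2 by rewrite mulr_ge0 ?sqr_ge0.
  by lra.
have Ex : y0 ^+ 2 * ((1 - x) / (1 - x0)) <= E x / k ^+ 2.
  rewrite ler_pdivlMr ?exprn_gt0//.
  rewrite -subr_ge0 (_ : _ - _ = E 1 * ((x - x0) / (1 - x0))).
    by rewrite mulr_ge0// divr_ge0//; lra.
  transitivity (E x - E x0 * ((1 - x) / (1 - x0))); first by rewrite Ex0; ring.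
  by rewrite /E; field.
have eqv y : ((y + h x) ^+ 2 < E x / k ^+ 2) = (Q (x, y) < 0).
  by rewrite ltr_pdivlMr ?exprn_gt0// [_ * k ^+ 2]mulrC -subr_lt0 -QE pmulr_rlt0.
rewrite [X in (_ <= lam X)%E](_ : _ = (fun y => y + h x) @^-1`
    [set y | lt_or_le true (y ^+ 2) (E x / k ^+ 2)]); last first.
  apply/seteqP; split => y; rewrite /xsection /preimage /lt_or_le /segment /below
    /mkset inE eqv; first by case.
  by move=> ?; split.
have [_ ->] := @preserves_shift R (h x); last first.
  by apply: measurable_lt_or_le; mfun.
rewrite measure_sqr_ball lee_fin /f ler_pM2l//.
rewrite -[y0](@gtr0_norm R)// -sqrtr_sqr -sqrtrM ?sqr_ge0//.
by rewrite ler_wsqrtr.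
Qed.

(** The triangle [0 A B], and the part beyond [A B] up to the tangent [x = 1] of
    the unit disc. *)
Let area_below_parabola : x0 < 1 ->
  ((y0 * (4 - x0) / 3)%:E <= area (sector `&` below))%E.
Proof.
move=> x01.
have sub : tri `|` segment `<=` sector `&` below.
  move=> v [vt|vs]; first by split; [exact: tri_sector | exact: tri_below].
  by split; [exact: segment_sector | case: vs].
have dis : tri `&` segment = set0.
  by apply/seteqP; split => // v [[/= h _] [[/= h' _] _]]; move: h'; lra.
apply: (@le_trans _ _ (area (tri `|` segment))).
  have /= -> := measureU area measurable_tri measurable_segment dis.
  rewrite area_tri (_ : _ / 3 = x0 * y0 + 4 / 3 * y0 * (1 - x0)); last by field.
  by rewrite EFinD leeD2l// area_segment.
apply: (le_measure area); rewrite ?inE//.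
  exact: measurableU.
by apply: measurableI => //; exact: measurable_sector.
Qed.

Let area_below_chord : ((x0 * y0)%:E <= area (sector `&` below))%E.
Proof.
rewrite -area_tri; apply: (le_measure area); rewrite ?inE//.
  by apply: measurableI => //; exact: measurable_sector.
by move=> v vt; split; [exact: tri_sector | exact: tri_below].
Qed.

(** In terms of the half-opening [al], where [x0 = rho * cos al] and
    [y0 = rho * sin al], the bounds by the triangle and by the parabolic piece
    become [chord_trig] and [parabola_trig]. They agree at [x0 = 1], that is, at
    [al = pi / 6], where equality holds: this is a sixth of the regular hexagon
    around the unit disc. *)
Lemma area_sector_below : y0 <= x0 ->
  ((3 * Num.sqrt 3 / (2 * pi))%:E * area sector <= area (sector `&` below))%E.
Proof.
have half (a b d : R) : a + b = d -> b <= a -> a < d * (1 / 2) -> False by lra.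
move=> yx; rewrite area_sector -EFinM; have xy := xy0; have x0p := x00; have y0p := y00.
have r0 := @rho_gt0 R; have r2 := @rho_sqr R; have p0 := pi_gt0 R.
pose t := y0 / (rho + x0); pose al := 2 * atan t.
have rx : 0 < rho + x0 by rewrite addr_gt0.
have t0 : 0 < t by rewrite divr_gt0.
have tt : 1 + t ^+ 2 = 2 * rho / (rho + x0).
  have y2 : y0 ^+ 2 = rho ^+ 2 - x0 ^+ 2 by rewrite -xy0 [x0 ^+ 2 + _]addrC addrK.
  by rewrite /t expr_div_n y2; field; rewrite gt_eqF.
(* [t] is the tangent of half of [al]. *)
have cost : cos (atan t) ^+ 2 = (rho + x0) / (2 * rho).
  by rewrite cos_atan exprVn sqr_sqrtr ?tt ?invf_div// -tt addr_ge0// sqr_ge0.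
have rt : t * (rho + x0) = y0 by rewrite /t divfK// gt_eqF.
have alE : al = atan t *+ 2 by rewrite /al mulr2n; lra.
have cosal : rho * cos al = x0.
  by rewrite alE cos_mulr2n cost mulr2n; field; rewrite gt_eqF.
have a1 := atan_gtNpi2 t; have a2 := atan_ltpi2 t.
have c1 : 0 < cos (atan t) by apply: cos_gt0_pihalf; rewrite a1 a2.
have sinal : rho * sin al = y0.
  rewrite alE sin_mulr2n mulr2n.
  have -> : sin (atan t) = t * cos (atan t).
    by rewrite -{2}(atanK t) /tan divfK// gt_eqF.
  transitivity (2 * rho * t * cos (atan t) ^+ 2); first by ring.
  by rewrite cost -rt; field; rewrite gt_eqF.
have al0 : 0 < al.
  by rewrite /al mulr_gt0// -(@atan0 R) lt_atan.
have alpi : al < pi by rewrite /al; lra.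
have al4 : al <= pi / 4.
  rewrite leNgt; apply/negP => h.
  have : cos al < cos (pi / 4).
    by rewrite ltr_cos// in_itv/=; apply/andP; split; lra.
  have := @cos_pi4_sqr R; have := @cos_pi4_gt0 R; set w := cos (pi / 4) => w0 w2.
  rewrite -(ltr_pM2l r0) cosal => xw.
  have : x0 ^+ 2 < (rho * w) ^+ 2.
    by rewrite ltr_sqr ?nnegrE ?(ltW x00)// mulr_ge0 ?(ltW r0) ?(ltW w0).
  rewrite exprMn w2; apply: half xy _.
  by rewrite ler_sqr ?nnegrE ?(ltW x00) ?(ltW y00).
have -> : 3 * Num.sqrt 3 / (2 * pi) * (2 * rho ^+ 2 * atan t) =
    2 * Num.sqrt 3 / pi * al.
  by rewrite r2 /al; move: p0; move: (pi : R) => p p0; field; rewrite gt_eqF.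
have [x01|x01] := ltP x0 1.
  apply: le_trans (area_below_parabola x01); rewrite lee_fin.
  have al6 : pi / 6 <= al.
    rewrite leNgt; apply/negP => h.
    have : cos (pi / 6) < cos al.
      by rewrite ltr_cos// in_itv/=; apply/andP; split; lra.
    rewrite cos_pi6 -(ltr_pM2l r0) cosal.
    by have := @rho_sqrt3 R; lra.
  have := @parabola_trig R al; rewrite al6 al4 => /(_ isT) /le_trans; apply.
  by rewrite cosal -sinal le_eqVlt; apply/orP; left; apply/eqP; field.
apply: le_trans area_below_chord; rewrite lee_fin.
have al6 : al <= pi / 6.
  rewrite leNgt; apply/negP => h.
  have : cos al < cos (pi / 6).
    by rewrite ltr_cos// in_itv/=; apply/andP; split; lra.
  rewrite cos_pi6 -(ltr_pM2l r0) cosal.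
  by have := @rho_sqrt3 R; lra.
have := @chord_trig R al; rewrite al6 (ltW al0) => /(_ isT) /le_trans; apply.
by rewrite -cosal -sinal -r2 le_eqVlt; apply/orP; left; apply/eqP; ring.
Qed.

End Sector.
End Wedge.

(** * The cone in which a parabola cuts the disc *)

Section Cone.
Context {R : realType}.
Local Notation R2 := (R * R)%type.

(** The point of the circle of radius [rho] on the ray through [v]. *)
Definition radial (v : R2) : R2 :=
  (rho / Num.sqrt (sqn v) * v.1, rho / Num.sqrt (sqn v) * v.2).

Lemma sqn_radial (v : R2) : 0 < sqn v -> sqn (radial v) = rho ^+ 2.
Proof.
move=> v0; have n0 : Num.sqrt (sqn v) != 0 by rewrite gt_eqF// sqrtr_gt0.
transitivity (rho ^+ 2 / Num.sqrt (sqn v) ^+ 2 * sqn v).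
  by rewrite /radial /sqn /=; field; rewrite -?/(sqn v) ?n0.
by rewrite sqr_sqrtr ?(ltW v0)// divfK// gt_eqF.
Qed.

Lemma radial_scale (x : R) (v : R2) : 0 < x ->
  radial (x * v.1, x * v.2) = radial v.
Proof.
move=> x0; rewrite /radial /=.
have -> : sqn (x * v.1, x * v.2) = x ^+ 2 * sqn v by rewrite /sqn /=; ring.
rewrite sqrtrM ?sqr_ge0// sqrtr_sqr gtr0_norm// invfM.
move: ((Num.sqrt (sqn v))^-1) => i.
by congr (_, _); field; rewrite gt_eqF.
Qed.

Lemma positive_near (f : R -> R) t : {for t, continuous f} -> 0 < f t ->
  exists2 e, 0 < e & forall s, `|s - t| < e -> 0 < f s.
Proof.
move=> cf ft; have : \forall s \near t, 0 < f s by exact: (cvgr_gt _ cf).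
move=> /nbhs_ballP[e /= e0 He]; exists e => // s st.
by apply: He; rewrite /ball /= distrC.
Qed.

Lemma open_convex_sup (J : set R) (M : R) : J 0 ->
  (forall s t, 0 <= s <= t -> J t -> J s) ->
  (forall t, J t -> exists2 e, 0 < e & J (t + e)) ->
  (forall t, J t -> t <= M) ->
  exists2 b, 0 < b & forall t, 0 <= t -> J t <-> t < b.
Proof.
move=> J0 Jc Jo JM.
have hs : has_sup J by split; [exists 0 | exists M].
have lts t : J t -> t < sup J.
  move=> /Jo [e e0 Je]; apply: (@lt_le_trans _ _ (t + e)); first by rewrite ltrDl.
  exact: (sup_upper_bound hs).
exists (sup J); first exact: lts.
move=> t t0; split; first exact: lts.
rewrite -subr_gt0 => /(@sup_adherent _ J); case => // s Js.
rewrite subKr => ts; apply: (Jc _ s) => //; lra.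
Qed.

Lemma open_convex_itv (J : set R) (M : R) : J 0 ->
  (forall r s t, r <= s <= t -> J r -> J t -> J s) ->
  (forall t, J t -> exists2 e, 0 < e & forall s, `|s - t| < e -> J s) ->
  (forall t, J t -> - M <= t <= M) ->
  exists a b, [/\ a < 0, 0 < b & forall t, J t <-> a < t < b].
Proof.
move=> J0 Jc Jo JM.
have [|||b b0 bJ] := @open_convex_sup J M J0.
- by move=> s t /andP[s0 st] Jt; apply: (Jc 0 s t) => //; rewrite s0.
- move=> t /Jo [e e0 He]; exists (e / 2); first by rewrite divr_gt0.
  by apply: He; rewrite addrAC subrr add0r gtr0_norm ?divr_gt0//; lra.
- by move=> t /JM /andP[].
have [||||a a0 aJ] := @open_convex_sup [set t | J (- t)] M.
- by rewrite /= oppr0.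
- by move=> s t /andP[s0 st] /= Jt; apply: (Jc (- t) (- s) 0) => //; rewrite lerN2 st oppr_le0.
- move=> t /= /Jo [e e0 He]; exists (e / 2); first by rewrite divr_gt0.
  by apply: He; rewrite opprD addrAC subrr add0r normrN gtr0_norm ?divr_gt0//; lra.
- by move=> t /= /JM /andP[]; lra.
exists (- a), b; split => //; first by rewrite oppr_lt0.
move=> t; have [t0|t0] := leP 0 t.
  by rewrite (bJ t t0); split => [->|/andP[]//]; rewrite andbT; lra.
have := aJ (- t); rewrite /= opprK => ->; last lra.
by split => [?|/andP[]]; [apply/andP; split|]; lra.
Qed.

Variables (l m : R2) (c : R).
Local Notation Q := (para l m c).
Hypotheses (Qacute : forall v w, sqn v = rho ^+ 2 -> sqn w = rho ^+ 2 ->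
    0 < Q v -> 0 < Q w -> 0 < dot2 v w)
  (Qconvex : forall v w p q, sqn v = rho ^+ 2 -> sqn w = rho ^+ 2 ->
    0 < Q v -> 0 < Q w -> 0 <= p -> 0 <= q ->
    sqn (p * v.1 + q * w.1, p * v.2 + q * w.2) = rho ^+ 2 ->
    0 < Q (p * v.1 + q * w.1, p * v.2 + q * w.2)).

(** The points seen from the origin in a direction in which the circle of radius
    [rho] lies beyond the parabola. *)
Definition cone : set R2 := [set v | 0 < sqn v /\ 0 < Q (radial v)].

(** The half-circle around a point [v0] where [Q > 0] is parametrized by the
    tangent [t] of the angle to [v0]. The parameters with [Q > 0] form an
    interval by [Qconvex], open by continuity and bounded by [Qacute]; [A] and
    [B] are the points at its two ends. *)
Lemma cone_wedge : cone = set0 \/ exists A B : R2,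
  [/\ sqn A = rho ^+ 2, sqn B = rho ^+ 2, 0 < cross A B, 0 <= dot2 A B &
      [/\ Q A = 0, Q B = 0 & cone = wedge A B]].
Proof.
have [->|/set0P[v' [v'0 Qv']]] := eqVneq cone set0; first by left.
right; have [v0 [sv0 Qv0]] : exists v, sqn v = rho ^+ 2 /\ 0 < Q v.
  by exists (radial v'); split => //; exact: sqn_radial.
have r0 := @rho_gt0 R; have r2 : 0 < (rho : R) ^+ 2 by rewrite exprn_gt0.
pose n t : R := Num.sqrt (1 + t ^+ 2).
have n20 (t : R) : 0 < 1 + t ^+ 2 by have := sqr_ge0 t; lra.
have n0 t : 0 < n t by rewrite sqrtr_gt0.
have nz t : n t != 0 by rewrite gt_eqF.
have nn t : n t ^+ 2 = 1 + t ^+ 2 by rewrite sqr_sqrtr// ltW.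
pose w t : R2 := ((v0.1 - t * v0.2) / n t, (v0.2 + t * v0.1) / n t).
have sw t : sqn (w t) = rho ^+ 2.
  transitivity ((1 + t ^+ 2) * sqn v0 / n t ^+ 2); last by rewrite sv0 nn mulrC mulKf// gt_eqF.
  by rewrite /w /sqn /=; field; rewrite ?nz.
have w0 : w 0 = v0.
  rewrite /w /n expr0n /= addr0 sqrtr1 !mul0r subr0 addr0 !divr1; by case: (v0).
have dotw s t : dot2 (w s) (w t) = rho ^+ 2 * (1 + s * t) / (n s * n t).
  by rewrite -sv0 /dot2 /sqn /w /=; field; rewrite ?nz ?gt_eqF.
have crossw s t : cross (w s) (w t) = rho ^+ 2 * (t - s) / (n s * n t).
  by rewrite -sv0 /cross /sqn /w /=; field; rewrite ?nz ?gt_eqF.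
have cw : continuous (fun t => Q (w t)).
  have cn : continuous n.
    move=> t; apply: continuous_comp; last exact: sqrt_continuous.
    by apply: cvgD; [exact: cvg_cst | exact: exprn_continuous].
  have c1 : continuous (fun t => (w t).1).
    move=> t; apply: cvgM; last by apply: cvgV; [rewrite gt_eqF | exact: cn].
    apply: cvgB; first exact: cvg_cst.
    by apply: cvgM; [exact: cvg_id | exact: cvg_cst].
  have c2 : continuous (fun t => (w t).2).
    move=> t; apply: cvgM; last by apply: cvgV; [rewrite gt_eqF | exact: cn].
    apply: cvgD; first exact: cvg_cst.
    by apply: cvgM; [exact: cvg_id | exact: cvg_cst].
  have cd (a : R2) : continuous (fun t => dot2 a (w t)).
    by move=> t; apply: cvgD; apply: cvgM; [exact: cvg_cst | exact: c1 | exact: cvg_cst | exact: c2].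
  move=> t; apply: cvgB; last exact: cvg_cst.
  by apply: cvgD; [apply: cvgM; exact: cd | exact: cd].
pose J := [set t | 0 < Q (w t)].
have J0 : J 0 by rewrite /J /= w0.
have Jopen t : J t -> exists2 e, 0 < e & forall s, `|s - t| < e -> J s.
  by move=> Jt; exact: (@positive_near (fun s => Q (w s)) t (cw t) Jt).
have Jdot s t : J s -> J t -> 0 < 1 + s * t.
  move=> Js Jt; have := Qacute (sw s) (sw t) Js Jt; rewrite dotw.
  have nst : 0 < (n s * n t)^-1 by rewrite invr_gt0 mulr_gt0.
  by rewrite (pmulr_lgt0 _ nst) (pmulr_rgt0 _ r2).
have Jconv r s t : r <= s <= t -> J r -> J t -> J s.
  move=> /andP[rs st] Jr Jt.
  move: rs; rewrite le_eqVlt => /predU1P[<-//|rs].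
  have rt : r < t by exact: lt_le_trans st.
  have rt0 : 0 < t - r by rewrite subr_gt0.
  pose p := n r / n s * ((t - s) / (t - r)); pose q := n t / n s * ((s - r) / (t - r)).
  have ws : w s = (p * (w r).1 + q * (w t).1, p * (w r).2 + q * (w t).2).
    by rewrite /w /p /q /=; congr (_, _); field; rewrite ?nz ?gt_eqF.
  rewrite /J /= ws; apply: Qconvex => //; rewrite -?ws//.
  - by rewrite /p mulr_ge0// divr_ge0//; [exact: ltW | exact: ltW | lra | exact: ltW].
  - by rewrite /q mulr_ge0// divr_ge0//; [exact: ltW | exact: ltW | lra | exact: ltW].
have [e e0 Je] := Jopen 0 J0.
have JM t : J t -> - (2 / e) <= t <= 2 / e.
  move=> Jt; have J1 : J (e / 2).
    by apply: Je; rewrite subr0 gtr0_norm; lra.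
  have J2 : J (- (e / 2)).
    by apply: Je; rewrite subr0 normrN gtr0_norm; lra.
  have := Jdot _ _ J1 Jt; have := Jdot _ _ J2 Jt => h1 h2.
  by rewrite lerNl ler_pdivlMr// ler_pdivlMr//; apply/andP; split; lra.
have [a [b [a0 b0 Jab]]] := open_convex_itv J0 Jconv Jopen JM.
have Qzero t : t = a \/ t = b -> Q (w t) = 0.
  move=> tab; apply/eqP; rewrite eq_le; apply/andP; split.
    rewrite leNgt; apply/negP => /Jab.
    by case: tab => ->; rewrite ltxx ?andbF.
  rewrite leNgt; apply/negP => Qt.
  have [||d d0 Hd] := @positive_near (fun s => - Q (w s)) t.
  - by apply: cvgN; exact: cw.
  - by rewrite oppr_gt0.
  pose s := if t == a then a + Num.min (d / 2) (b - a) / 2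
            else b - Num.min (d / 2) (b - a) / 2.
  have m0 : 0 < Num.min (d / 2) (b - a) by rewrite lt_min; apply/andP; split; lra.
  have m1 : Num.min (d / 2) (b - a) <= d / 2 by rewrite ge_min lexx.
  have m2 : Num.min (d / 2) (b - a) <= b - a by rewrite ge_min lexx orbT.
  have Js : J s.
    by apply/Jab; rewrite /s; case: ifPn => _; apply/andP; split; lra.
  have : `|s - t| < d.
    rewrite /s; case: eqP => [->|ta]; last case: tab => // ->.
      by rewrite addrAC subrr add0r gtr0_norm; lra.
    by rewrite addrAC subrr add0r normrN gtr0_norm; lra.
  by move=> /Hd; rewrite oppr_gt0 ltNge ltW.
have ab1 : 0 <= 1 + a * b.
  have sb s : J s -> 0 <= 1 + s * b.
    move=> Js; rewrite leNgt; apply/negP => h.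
    have s0 : s < 0 by rewrite ltNge; apply/negP => s0; nra.
    have t1 : 0 < - s^-1 by rewrite oppr_gt0 invr_lt0.
    have tb : - s^-1 < b.
      by rewrite -(ltr_nM2l s0) mulrN divff ?lt_eqF//; lra.
    have Jt : J (- s^-1) by apply/Jab; rewrite tb andbT; lra.
    by have := Jdot _ _ Js Jt; rewrite mulrN divff ?lt_eqF// subrr ltxx.
  rewrite leNgt; apply/negP => h.
  have tb : a < - b^-1.
    by rewrite -(ltr_pM2l b0) mulrN divff ?gt_eqF// mulrC; lra.
  have t0 : - b^-1 < 0 by rewrite oppr_lt0 invr_gt0.
  pose s := (a + - b^-1) / 2.
  have : J s by apply/Jab; rewrite /s; apply/andP; split; lra.
  move=> /sb; have : s * b = (a * b - 1) / 2.
    by rewrite /s; field; rewrite ?nz ?gt_eqF.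
  by lra.
exists (w a), (w b); split => //.
- by rewrite crossw divr_gt0 ?mulr_gt0//; lra.
- by rewrite dotw divr_ge0 ?mulr_ge0 ?(ltW r2)// ltW.
split; [by apply: Qzero; left | by apply: Qzero; right |].
have cr t v : cross (w t) v = (cross v0 v - t * dot2 v0 v) / n t.
  by rewrite /cross /dot2 /w /=; field; rewrite ?nz ?gt_eqF.
have cr' t v : cross v (w t) = (t * dot2 v0 v - cross v0 v) / n t.
  by rewrite /cross /dot2 /w /=; field; rewrite ?nz ?gt_eqF.
have decomp v : 0 < dot2 v0 v ->
    v = (dot2 v0 v / rho ^+ 2 * (v0.1 - cross v0 v / dot2 v0 v * v0.2),
         dot2 v0 v / rho ^+ 2 * (v0.2 + cross v0 v / dot2 v0 v * v0.1)).
  move=> d0; rewrite -sv0; case: v d0 => x y d0 /=.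
  have s0 : v0.1 ^+ 2 + v0.2 ^+ 2 != 0 by rewrite -/(sqn v0) sv0 gt_eqF.
  have dn : v0.1 * x + v0.2 * y != 0 by rewrite -/(dot2 v0 (x, y)) gt_eqF.
  by rewrite /dot2 /cross /sqn /=; congr (_, _); field; rewrite ?s0 ?dn.
have radw v : 0 < dot2 v0 v -> radial v = w (cross v0 v / dot2 v0 v).
  move=> d0; rewrite {1}(decomp v d0).
  set t := cross v0 v / _; set x := dot2 v0 v / _.
  have x0 : 0 < x by rewrite divr_gt0.
  rewrite (@radial_scale x (v0.1 - t * v0.2, v0.2 + t * v0.1))//.
  rewrite /radial (_ : sqn _ = rho ^+ 2 * (1 + t ^+ 2)); last first.
    by rewrite -sv0 /sqn /=; ring.
  rewrite sqrtrM ?ltW// sqrtr_sqr gtr0_norm// -/(n t) /w /=.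
  by congr (_, _); field; rewrite ?nz ?gt_eqF.
apply/seteqP; split => v.
  move=> [sv Qv].
  have d0 : 0 < dot2 v0 v.
    have := Qacute sv0 (sqn_radial sv) Qv0 Qv.
    rewrite /radial /dot2 /= => h.
    rewrite -(pmulr_rgt0 _ (divr_gt0 r0 (_ : 0 < Num.sqrt (sqn v)))) ?sqrtr_gt0//.
    by apply: lt_le_trans h _; rewrite le_eqVlt; apply/orP; left; apply/eqP; ring.
  have : J (cross v0 v / dot2 v0 v) by rewrite /J /= -radw.
  move=> /Jab /andP[]; rewrite ltr_pdivlMr// ltr_pdivrMr// => h1 h2.
  by split; rewrite ?cr ?cr' divr_gt0//; lra.
move=> []; rewrite cr cr' => h1 h2.
have {}h1 : 0 < cross v0 v - a * dot2 v0 v by move: h1; rewrite pmulr_lgt0 ?invr_gt0.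
have {}h2 : 0 < b * dot2 v0 v - cross v0 v by move: h2; rewrite pmulr_lgt0 ?invr_gt0.
have d0 : 0 < dot2 v0 v.
  have : 0 < (b - a) * dot2 v0 v by lra.
  by rewrite pmulr_rgt0//; lra.
split.
  rewrite lt_neqAle addr_ge0 ?sqr_ge0// andbT eq_sym.
  apply: contraTneq d0 => /eqP; rewrite paddr_eq0 ?sqr_ge0// !sqrf_eq0.
  by move=> /andP[/eqP e1 /eqP e2]; rewrite /dot2 e1 e2 !mulr0 addr0 ltxx.
rewrite radw//; apply/Jab; rewrite ltr_pdivlMr// ltr_pdivrMr//.
by apply/andP; split; lra.
Qed.

End Cone.

Section ConeArea.
Context {R : realType}.
Local Notation R2 := (R * R)%type.

Lemma sqn_rot2 (u s : R) v : u ^+ 2 + s ^+ 2 = 1 -> sqn (rot2 u s v) = sqn v.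
Proof.
move=> us; transitivity ((u ^+ 2 + s ^+ 2) * sqn v); last by rewrite us mul1r.
by rewrite /sqn /rot2 /=; ring.
Qed.

Lemma cross_rot2 (u s : R) v w : u ^+ 2 + s ^+ 2 = 1 ->
  cross (rot2 u s v) (rot2 u s w) = cross v w.
Proof.
move=> us; transitivity ((u ^+ 2 + s ^+ 2) * cross v w); last by rewrite us mul1r.
by rewrite /cross /rot2 /=; ring.
Qed.

Lemma para_rot2 (u s : R) l m c v :
  para l m c (rot2 u s v) =
  para (u * l.1 + s * l.2, u * l.2 - s * l.1) (u * m.1 + s * m.2, u * m.2 - s * m.1) c v.
Proof. by rewrite /para /dot2 /rot2 /=; ring. Qed.

(** Two vectors of equal length are symmetric about their bisector. *)
Lemma bisector_frame (A B : R2) (r : R) : 0 < r ->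
  sqn A = r ^+ 2 -> sqn B = r ^+ 2 -> 0 < cross A B -> 0 <= dot2 A B ->
  exists u s x0 y0 : R, [/\ u ^+ 2 + s ^+ 2 = 1, 0 < y0 <= x0,
    x0 ^+ 2 + y0 ^+ 2 = r ^+ 2, A = rot2 u s (x0, - y0) & B = rot2 u s (x0, y0)].
Proof.
move=> r0 sA sB cAB dAB.
have r2 : 0 < r ^+ 2 by rewrite exprn_gt0.
pose S := sqn (A.1 + B.1, A.2 + B.2).
have SE : S = 2 * (r ^+ 2 + dot2 A B).
  by rewrite /S /sqn /dot2 /=; move: sA sB; rewrite /sqn => sA sB; lra.
have S0 : 0 < S by rewrite SE; lra.
have [x0 [x00 xx]] : exists x0 : R, 0 < x0 /\ 4 * x0 ^+ 2 = S.
  exists (Num.sqrt S / 2); split; first by rewrite divr_gt0 ?sqrtr_gt0.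
  by rewrite expr_div_n sqr_sqrtr ?ltW//; field.
have xn : x0 != 0 by rewrite gt_eqF.
pose u := (A.1 + B.1) / (2 * x0); pose s := (A.2 + B.2) / (2 * x0).
pose y0 := cross A B / (2 * x0).
have us : u ^+ 2 + s ^+ 2 = 1.
  transitivity (S / (4 * x0 ^+ 2)); last by rewrite xx divff ?gt_eqF.
  by rewrite /u /s /S /sqn /=; field.
have ux : x0 * u = (A.1 + B.1) / 2 by rewrite /u; field.
have sx : x0 * s = (A.2 + B.2) / 2 by rewrite /s; field.
have perp : (A.1 + B.1) * (B.1 - A.1) + (A.2 + B.2) * (B.2 - A.2) = 0.
  by move: sA sB; rewrite /sqn => sA sB; lra.
have sy : s * y0 = (A.1 - B.1) / 2.
  have -> : s * y0 = (A.2 + B.2) * cross A B / (4 * x0 ^+ 2) by rewrite /s /y0; field.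
  rewrite xx; apply: (mulIf (lt0r_neq0 S0)); rewrite divfK ?gt_eqF//.
  transitivity ((A.1 - B.1) / 2 * S + (A.1 + B.1) / 2 * ((A.1 + B.1) * (B.1 - A.1) + (A.2 + B.2) * (B.2 - A.2))).
    by rewrite /cross /S /sqn /=; field.
  by rewrite perp mulr0 addr0.
have uy : u * y0 = (B.2 - A.2) / 2.
  have -> : u * y0 = (A.1 + B.1) * cross A B / (4 * x0 ^+ 2) by rewrite /u /y0; field.
  rewrite xx; apply: (mulIf (lt0r_neq0 S0)); rewrite divfK ?gt_eqF//.
  transitivity ((B.2 - A.2) / 2 * S - (A.2 + B.2) / 2 * ((A.1 + B.1) * (B.1 - A.1) + (A.2 + B.2) * (B.2 - A.2))).
    by rewrite /cross /S /sqn /=; field.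
  by rewrite perp mulr0 subr0.
have AE : A = rot2 u s (x0, - y0).
  by rewrite /rot2 /=; case: (A) ux sx sy uy => a1 a2 /= ux sx sy uy;
    congr (_, _); lra.
have BE : B = rot2 u s (x0, y0).
  by rewrite /rot2 /=; case: (B) ux sx sy uy => a1 a2 /= ux sx sy uy;
    congr (_, _); lra.
have y00 : 0 < y0 by rewrite /y0 divr_gt0// mulr_gt0.
have xy : x0 ^+ 2 + y0 ^+ 2 = r ^+ 2 by rewrite -sB BE sqn_rot2.
exists u, s, x0, y0; split => //; rewrite y00 /= -ler_sqr ?nnegrE ?(ltW x00) ?(ltW y00)//.
by move: xx; rewrite SE; lra.
Qed.

Variables (l m : R2) (c : R).
Local Notation Q := (para l m c).
Hypotheses (c0 : 0 < c) (Qunit : forall v, sqn v <= 1 -> Q v <= 0)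
  (Qacute : forall v w, sqn v = rho ^+ 2 -> sqn w = rho ^+ 2 ->
    0 < Q v -> 0 < Q w -> 0 < dot2 v w)
  (Qconvex : forall v w p q, sqn v = rho ^+ 2 -> sqn w = rho ^+ 2 ->
    0 < Q v -> 0 < Q w -> 0 <= p -> 0 <= q ->
    sqn (p * v.1 + q * w.1, p * v.2 + q * w.2) = rho ^+ 2 ->
    0 < Q (p * v.1 + q * w.1, p * v.2 + q * w.2)).

Lemma measurable_cone : measurable (cone l m c).
Proof.
have [->|[A [B [_ _ _ _ [_ _ ->]]]]] := cone_wedge Qacute Qconvex => //.
exact: measurable_wedge.
Qed.

(** A rotation puts the bisector of the cone on the first axis, where
    [area_sector_below] applies. *)
Lemma area_cone_below :
  ((3 * Num.sqrt 3 / (2 * pi))%:E * area (odisc rho `&` cone l m c) <=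
   area (odisc rho `&` cone l m c `&` below l m c))%E.
Proof.
have mo := @measurable_odisc R rho.
have [->|[A [B [sA sB cAB dAB [QA QB coneE]]]]] := cone_wedge Qacute Qconvex.
  by rewrite setI0 set0I !measure0 mule0.
have [u [s [x0 [y0 [us /andP[y00 yx] xy AE BE]]]]] :=
  bisector_frame (@rho_gt0 R) sA sB cAB dAB.
have x00 : 0 < x0 by exact: lt_le_trans yx.
have [mr pr] := preserves_rot2 us.
have mc := measurable_cone.
have mb : measurable (below l m c).
  by apply: measurable_set_lt; [exact: measurable_para | exact: measurable_cst].
have moc : measurable (odisc rho `&` cone l m c) by exact: measurableI.
rewrite -(pr _ moc) -(pr _ (measurableI _ _ moc mb)).
pose l' := (u * l.1 + s * l.2, u * l.2 - s * l.1).
pose m' := (u * m.1 + s * m.2, u * m.2 - s * m.1).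
have wE v : wedge A B (rot2 u s v) <-> wedge (x0, - y0) (x0, y0) v.
  by rewrite /wedge /= AE BE !cross_rot2.
have e1 : rot2 u s @^-1` (odisc rho `&` cone l m c) = sector x0 y0.
  apply/seteqP; split => v.
    move=> [/= ov]; rewrite coneE => /wE wv; split => //.
    by move: ov; rewrite /odisc /= sqn_rot2.
  move=> [wv ov]; split; last by rewrite coneE; apply/wE.
  by move: ov; rewrite /odisc /= sqn_rot2.
have e2 : rot2 u s @^-1` (odisc rho `&` cone l m c `&` below l m c) =
    sector x0 y0 `&` below l' m' c.
  rewrite preimage_setI e1; congr (_ `&` _).
  by apply/seteqP; split => v; rewrite /below /= para_rot2.
rewrite e1 e2; apply: area_sector_below => //.
- by move=> v v1; rewrite -para_rot2; apply: Qunit; rewrite sqn_rot2.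
- by rewrite -para_rot2 -AE.
- by rewrite -para_rot2 -BE.
move=> v wv sv; rewrite -para_rot2.
have : wedge A B (rot2 u s v) by apply/wE.
rewrite -coneE => -[_]; congr (0 < Q _).
have rn := @rho_gt0 R.
rewrite /radial sqn_rot2// sv sqrtr_sqr gtr0_norm// divff ?gt_eqF// !mul1r.
by case: (rot2 u s v).
Qed.

(** [Q] is nonnegative at [v], so it is positive farther out on the same ray. *)
Lemma odisc_cone v : odisc rho v -> 0 <= Q v -> cone l m c v.
Proof.
move=> ov Qv.
have v0 : 0 < sqn v.
  rewrite lt_neqAle addr_ge0 ?sqr_ge0// andbT eq_sym.
  apply: contraTneq Qv => /eqP; rewrite paddr_eq0 ?sqr_ge0// !sqrf_eq0.
  move=> /andP[/eqP e1 /eqP e2]; rewrite /para /dot2 e1 e2 !mulr0 !addr0 expr0n /=.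
  by have := c0; rewrite -ltNge; lra.
split => //; pose n := Num.sqrt (sqn v).
have n0 : 0 < n by rewrite sqrtr_gt0.
have rn := @rho_gt0 R.
have nr : n < rho.
  by rewrite -ltr_sqr ?nnegrE ?(ltW n0) ?(ltW rn)// sqr_sqrtr// ltW.
pose t := n / rho; have t0 : 0 < t by rewrite divr_gt0.
have t1 : t < 1 by rewrite ltr_pdivrMr// mul1r.
have tt : 0 <= t <= 1 by rewrite !ltW.
have := @para_scale R l m c t (radial v) tt.
have -> : (t * (radial v).1, t * (radial v).2) = v.
  rewrite /radial /= -/n /t; case: (v) => x y /=.
  by congr (_, _); field; rewrite !gt_eqF.
move=> h; rewrite -(pmulr_rgt0 _ t0).
have : 0 < (1 - t) * c by rewrite mulr_gt0// subr_gt0.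
by lra.
Qed.

End ConeArea.

(** * Two axes seen from a cross-section *)

Section Dot.
Context {R : realType}.
Implicit Types x y z : R3 R.

Lemma dotC x y : dot x y = dot y x.
Proof. by rewrite /dot; ring. Qed.

Lemma dotDl x y z : dot (x + y) z = dot x z + dot y z.
Proof. by rewrite /dot /=; ring. Qed.

Lemma dotZl (k : R) x y : dot (k *: x) y = k * dot x y.
Proof. by rewrite /dot /= /GRing.scale /=; ring. Qed.

Lemma dotNl x y : dot (- x) y = - dot x y.
Proof. by rewrite /dot /=; ring. Qed.

Lemma dotDr x y z : dot z (x + y) = dot z x + dot z y.
Proof. by rewrite dotC dotDl !(dotC z). Qed.

Lemma dotZr (k : R) x y : dot y (k *: x) = k * dot y x.
Proof. by rewrite dotC dotZl (dotC y). Qed.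

Lemma dotNr x y : dot y (- x) = - dot y x.
Proof. by rewrite dotC dotNl (dotC y). Qed.

Definition dotE := (dotDl, dotDr, dotZl, dotZr, dotNl, dotNr).

Lemma dot_ge0 x : 0 <= dot x x.
Proof. by rewrite /dot !addr_ge0// -expr2 sqr_ge0. Qed.

Lemma dot_sqr_le x y : dot x x = 1 -> dot x y ^+ 2 <= dot y y.
Proof.
move=> xx; have := dot_ge0 (y - dot x y *: x).
rewrite !dotE xx (dotC y x) expr2; lra.
Qed.

Lemma dist_line_expand x y z (t : R) :
  dot (x - (y + t *: z)) (x - (y + t *: z)) =
  dot x x - 2 * dot y x - 2 * t * dot z x + dot y y + 2 * t * dot z y + t ^+ 2 * dot z z.
Proof. by rewrite /dot /= /GRing.scale /=; ring. Qed.

Lemma sum_sqr_le x y : dot (x + y) (x + y) <= 2 * dot x x + 2 * dot y y.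
Proof. by have := dot_ge0 (x - y); rewrite !dotE (dotC y x); lra. Qed.

Lemma midpoint_sqr x y : dot (2^-1 *: (x + y)) (2^-1 *: (x + y)) =
  (dot x x + 2 * dot x y + dot y y) / 4.
Proof. by rewrite /dot /= /GRing.scale /=; field. Qed.

Lemma midpoint_sqr_le x y :
  dot (2^-1 *: (x + y)) (2^-1 *: (x + y)) <= (dot x x + dot y y) / 2.
Proof. by have := sum_sqr_le x y; rewrite dotZl dotZr; lra. Qed.

(** The component of [y] perpendicular to [n] is shorter than [rho], so [v] is
    longer than [2 - rho], which exceeds [rho / sqrt 2]. *)
Lemma long_of_far (n y v : R3 R) : dot n n = 1 -> dot n v = 0 -> dot y y < 4 / 3 ->
  4 <= dot (y + v - dot n (y + v) *: n) (y + v - dot n (y + v) *: n) ->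
  2 / 3 < dot v v.
Proof.
move=> nn nv yy; rewrite (dotDr y v n) nv addr0; set s := dot n y => h.
have := dot_ge0 ((7 / 10) *: (y - s *: n) - v).
have := sqr_ge0 s; move: h.
rewrite !dotE nn (dotC v n) (dotC y n) (dotC v y) nv -/s expr2; lra.
Qed.

Lemma R3_ext x y : x.1.1 = y.1.1 -> x.1.2 = y.1.2 -> x.2 = y.2 -> x = y.
Proof. by case: x y => [[? ?] ?] [[? ?] ?] /= -> -> ->. Qed.

Lemma dot_subC x y : dot (x - y) (x - y) = dot (y - x) (y - x).
Proof. by rewrite /dot /=; ring. Qed.

End Dot.

Ltac R3_ring := apply: R3_ext; rewrite /= /GRing.scale /=; ring.
Ltac R3_field := apply: R3_ext; rewrite /= /GRing.scale /=; field.

Section Slice.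
Context {R : realType}.
Local Notation R2 := (R * R)%type.
Variables n a b : R3 R.
Hypotheses (nn : dot n n = 1) (aa : dot a a = 1) (bb : dot b b = 1)
  (ab : dot a b = 0) (an : dot a n = 0) (bn : dot b n = 0).

Definition plane (w : R2) : R3 R := w.1 *: a + w.2 *: b.

Lemma dot_plane v w : dot (plane v) (plane w) = dot2 v w.
Proof. by rewrite /plane !dotE (dotC b a) aa bb ab /dot2; ring. Qed.

Lemma dot_plane_sqn v : dot (plane v) (plane v) = sqn v.
Proof. by rewrite dot_plane /dot2 /sqn !expr2. Qed.

Lemma dot_plane_n v : dot (plane v) n = 0.
Proof. by rewrite /plane !dotE an bn !mulr0 addr0. Qed.

Section OneAxis.
(** The line [e + t *: u]; [g] is its point nearest to the origin. *)
Variables (e u : R3 R).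
Hypothesis uu : dot u u = 1.

Definition nearest : R3 R := e - dot u e *: u.
Local Notation g := nearest.

Definition slice_l : R2 := (dot u a, dot u b).
Definition slice_m : R2 := (2 * dot g a, 2 * dot g b).
Definition slice_c : R := dot g g.
Local Notation Q := (para slice_l slice_m slice_c).

Lemma nearest_perp : dot u g = 0.
Proof. by rewrite /nearest !dotE uu; ring. Qed.

Lemma dot_slice_l w : dot2 slice_l w = dot u (plane w).
Proof. by rewrite /plane !dotE /dot2 /=; ring. Qed.

Lemma dot_slice_m w : dot2 slice_m w = 2 * dot g (plane w).
Proof. by rewrite /plane dotDr !dotZr /dot2 /=; ring. Qed.

Lemma nearestE t : e + t *: u = g + (dot u e + t) *: u.
Proof. by rewrite /nearest; R3_ring. Qed.

(** [Q] compares the squared distances to the origin and to the line: the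
    squared distance from [plane w] to the line is [sqn w - Q w]. *)
Lemma dist_line w t :
  dot (plane w - (g + t *: u)) (plane w - (g + t *: u)) =
  sqn w - Q w + (dot u (plane w) - t) ^+ 2.
Proof.
rewrite dist_line_expand dot_plane_sqn nearest_perp uu /para dot_slice_l.
by rewrite dot_slice_m /slice_c; ring.
Qed.

(** Only the pieces near the origin are constrained, since the two lines go on
    beyond the ends of the cylinders. *)
Hypothesis far : forall t s, dot (e + t *: u) (e + t *: u) <= 9 -> s ^+ 2 <= 9 ->
  4 <= dot (e + t *: u - s *: n) (e + t *: u - s *: n).

Let far_nearest t s : dot (g + t *: u) (g + t *: u) <= 9 -> s ^+ 2 <= 9 ->
  4 <= dot (g + t *: u - s *: n) (g + t *: u - s *: n).
Proof.
have -> : g + t *: u = e + (t - dot u e) *: u by rewrite nearestE subrKC.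
exact: far.
Qed.

Lemma slice_c_ge4 : 4 <= slice_c.
Proof.
rewrite leNgt; apply/negP => c4.
have := @far_nearest 0 0; rewrite !scale0r subr0 addr0 -/slice_c expr0n /=.
by move=> /(_ ltac:(lra) ltac:(lra)); lra.
Qed.

(** A point nearer to the line than to the origin has its foot on the line within
    twice its own norm, hence on the piece of the line that is known to stay away
    from the axis. *)
Lemma near_line w : 0 < Q w ->
  dot (plane w - (g + dot u (plane w) *: u)) (plane w - (g + dot u (plane w) *: u)) < sqn w /\
  dot (g + dot u (plane w) *: u) (g + dot u (plane w) *: u) < 4 * sqn w.
Proof.
move=> Qw; have h := dist_line w (dot u (plane w)).
move: h; rewrite subrr expr0n /= addr0 => h.
split; first by rewrite h; lra.
set f := g + _ in h *.
have := sum_sqr_le (f - plane w) (plane w); rewrite subrK dot_plane_sqn.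
rewrite (dot_subC f).
by rewrite h; lra.
Qed.

Lemma slice_unit w : sqn w <= 1 -> Q w <= 0.
Proof.
move=> w1; rewrite leNgt; apply/negP => Qw; have [_ fw] := near_line Qw.
have := @far_nearest (dot u (plane w)) 0; rewrite scale0r subr0 expr0n /=.
by move=> /(_ ltac:(lra) ltac:(lra)); lra.
Qed.

(** Two directions in which the circle of radius [rho] is nearer to the line
    make an acute angle: otherwise the midpoint of their nearest points would
    be closer than [rho + rho / sqrt 2 < 2] to the axis. *)
Lemma slice_acute v w : sqn v = rho ^+ 2 -> sqn w = rho ^+ 2 ->
  0 < Q v -> 0 < Q w -> 0 < dot2 v w.
Proof.
move=> sv sw Qv Qw; have [v1 v2] := near_line Qv; have [w1 w2] := near_line Qw.
have r2 := @rho_sqr R; rewrite sv r2 in v1 v2; rewrite sw r2 in w1 w2.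
set tv := dot u (plane v) in v1 v2; set tw := dot u (plane w) in w1 w2.
set fv := g + tv *: u in v1 v2; set fw := g + tw *: u in w1 w2.
pose f := g + ((tv + tw) / 2) *: u.
have fE : f = 2^-1 *: (fv + fw).
  by rewrite /f /fv /fw; move: g => h; R3_field.
have f4 : dot f f < 16 / 3.
  by have := midpoint_sqr_le fv fw; rewrite -fE; lra.
have s9 : dot n f ^+ 2 <= 9 by have := dot_sqr_le f nn; lra.
have f9 : dot f f <= 9 by lra.
have far4 := far_nearest f9 s9.
pose V := 2^-1 *: (plane v + plane w).
have nV : dot n V = 0.
  by rewrite /V dotC dotZl dotDl (dot_plane_n v) (dot_plane_n w) addr0 mulr0.
have fV : dot (f - V) (f - V) < 4 / 3.
  have -> : f - V = 2^-1 *: ((fv - plane v) + (fw - plane w)).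
    by rewrite fE /V; move: (plane v) (plane w) (fv) (fw) => *; R3_field.
  have := midpoint_sqr_le (fv - plane v) (fw - plane w).
  by rewrite (dot_subC fv) (dot_subC fw); lra.
have := long_of_far nn nV fV; rewrite subrK => /(_ far4).
rewrite /V midpoint_sqr !dot_plane_sqn sv sw r2 dot_plane.
by lra.
Qed.

(** At [p v + q w] the value of [Q] exceeds [p Q(v) + q Q(w)] by at least
    [(p + q - 1) * slice_c - p * q * |v - w| ^ 2]. Here [slice_c >= 4], and as
    the point lies on the circle, the subtracted term is
    [4 / 3 * (p + q - 1) * (p + q + 1)], where [p + q <= sqrt 2] because [v] and
    [w] make an acute angle. *)
Lemma slice_convex v w p q : sqn v = rho ^+ 2 -> sqn w = rho ^+ 2 ->
  0 < Q v -> 0 < Q w -> 0 <= p -> 0 <= q ->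
  sqn (p * v.1 + q * w.1, p * v.2 + q * w.2) = rho ^+ 2 ->
  0 < Q (p * v.1 + q * w.1, p * v.2 + q * w.2).
Proof.
move=> sv sw Qv Qw p0 q0 spq.
have vw := slice_acute sv sw Qv Qw; have c4 := slice_c_ge4.
have r2 := @rho_sqr R.
pose D := sqn (v.1 - w.1, v.2 - w.2).
have DE : D = 2 * rho ^+ 2 - 2 * dot2 v w.
  transitivity (sqn v + sqn w - 2 * dot2 v w); last by rewrite sv sw; ring.
  by rewrite /D /sqn /dot2 /=; ring.
have pq : p * q * D = rho ^+ 2 * ((p + q) ^+ 2 - 1).
  rewrite mulrBr mulr1 -{2}spq DE.
  have -> : sqn (p * v.1 + q * w.1, p * v.2 + q * w.2) =
    p ^+ 2 * sqn v + q ^+ 2 * sqn w + 2 * p * q * dot2 v w.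
    by rewrite /sqn /dot2 /=; ring.
  by rewrite sv sw; ring.
have D0 : 0 <= D by rewrite /D addr_ge0 ?sqr_ge0.
have pq0 : 0 <= p * q by rewrite mulr_ge0.
have P1 : 1 <= (p + q) ^+ 2.
  have : 0 <= p * q * D by rewrite mulr_ge0.
  by rewrite pq r2; lra.
have P2 : (p + q) ^+ 2 <= 2.
  have : (p - q) ^+ 2 >= 0 by exact: sqr_ge0.
  have : 0 <= p * q * dot2 v w by rewrite mulr_ge0// ltW.
  move: pq; rewrite DE r2 !expr2; lra.
have P1' : 1 <= p + q by rewrite -(expr_ge1 (n := 2))// addr_ge0.
have P2' : p + q <= 3 / 2 by nra.
pose L1 := dot2 slice_l v; pose L2 := dot2 slice_l w.
have LL : (L1 - L2) ^+ 2 <= D.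
  have := dot_sqr_le (plane (v.1 - w.1, v.2 - w.2)) uu.
  rewrite -dot_slice_l dot_plane_sqn -/D; congr (_ <= _).
  by congr (_ ^+ 2); rewrite /L1 /L2 /dot2 /=; ring.
have -> : Q (p * v.1 + q * w.1, p * v.2 + q * w.2) =
    p * Q v + q * Q w + (p + q - 1) * (slice_c + p * L1 ^+ 2 + q * L2 ^+ 2)
    - p * q * (L1 - L2) ^+ 2.
  by rewrite /para /L1 /L2 /dot2 /=; ring.
have h1 : p * q * (L1 - L2) ^+ 2 <= 4 / 3 * ((p + q - 1) * (p + q + 1)).
  apply: (le_trans (ler_wpM2l pq0 LL)); rewrite pq r2 le_eqVlt; apply/orP; left.
  by apply/eqP; ring.
have h2 : (p + q - 1) * 4 <= (p + q - 1) * (slice_c + p * L1 ^+ 2 + q * L2 ^+ 2).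
  apply: ler_wpM2l; first lra.
  have : 0 <= p * L1 ^+ 2 by rewrite mulr_ge0// sqr_ge0.
  have : 0 <= q * L2 ^+ 2 by rewrite mulr_ge0// sqr_ge0.
  lra.
have h3 : (p + q - 1) * (p + q + 1) <= (p + q - 1) * 3 by apply: ler_wpM2l; lra.
have h4 : 0 < p * Q v + q * Q w.
  have [p00|p00] := eqVneq p 0.
    by rewrite p00 mul0r add0r mulr_gt0//; lra.
  by rewrite ltr_wpDr ?mulr_ge0 ?(ltW Qw)// mulr_gt0// lt_neqAle eq_sym p00.
by lra.
Qed.

End OneAxis.
End Slice.

(** * The Dirichlet cell in a cross-section *)

Section Cell.
Context {R : realType} (I : countType).
Local Notation R2 := (R * R)%type.
Variables (n a b : R3 R).
Hypotheses (nn : dot n n = 1) (aa : dot a a = 1) (bb : dot b b = 1)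
  (ab : dot a b = 0) (an : dot a n = 0) (bn : dot b n = 0).
Variables (e u : I -> R3 R) (J : set I).
Hypotheses (uu : forall j, dot (u j) (u j) = 1)
  (far : forall j, J j -> forall t s,
    dot (e j + t *: u j) (e j + t *: u j) <= 9 -> s ^+ 2 <= 9 ->
    4 <= dot (e j + t *: u j - s *: n) (e j + t *: u j - s *: n))
  (apart : forall j k, J j -> J k -> j != k -> forall t s,
    dot (e j + t *: u j) (e j + t *: u j) <= 9 ->
    dot (e k + s *: u k) (e k + s *: u k) <= 9 ->
    4 <= dot (e j + t *: u j - (e k + s *: u k))
             (e j + t *: u j - (e k + s *: u k))).

Local Notation l j := (slice_l a b (u j)).
Local Notation m j := (slice_m a b (e j) (u j)).
Local Notation c j := (slice_c (e j) (u j)).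
Local Notation Q j := (para (l j) (m j) (c j)).

(** [Q j w < 0] says that [w] is nearer to the axis than to line [j]. *)
Definition slice_cell : set R2 := [set w | odisc rho w /\ forall j, J j -> Q j w < 0].

Lemma measurable_slice_cell : measurable slice_cell.
Proof.
rewrite (_ : slice_cell = odisc rho `&` \bigcap_(j in J) below (l j) (m j) (c j)).
  apply: measurableI; first exact: measurable_odisc.
  apply: countable_bigcap_measurable => j.
  by apply: measurable_set_lt; [exact: measurable_para | exact: measurable_cst].
by apply/seteqP; split => w [].
Qed.

Let c_gt0 j : J j -> 0 < c j.
Proof. by move=> Jj; apply: lt_le_trans (slice_c_ge4 (far Jj)). Qed.

Let mcone j : J j -> measurable (cone (l j) (m j) (c j)).
Proof.
move=> Jj; apply: measurable_cone.
- exact: (slice_acute nn aa bb ab an bn (uu j) (far Jj)).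
- exact: (slice_convex nn aa bb ab an bn (uu j) (far Jj)).
Qed.

Let S j : set R2 := if `[< J j >] then odisc rho `&` cone (l j) (m j) (c j) else set0.
Let N j : set R2 := S j `\` below (l j) (m j) (c j).

Let mS j : measurable (S j).
Proof.
rewrite /S; case: asboolP => // Jj.
by apply: measurableI; [exact: measurable_odisc | exact: mcone].
Qed.

Let mbelow j : measurable (below (l j) (m j) (c j)).
Proof. by apply: measurable_set_lt; [exact: measurable_para | exact: measurable_cst]. Qed.

Let mN j : measurable (N j).
Proof. exact: measurableD. Qed.

(** The squared sides of a triangle add up to at most three times the sum of the
    squared distances of its vertices to any point, with equality at the
    centroid. So the three points do not lie in an open ball of radius [rho]. *)
Lemma three_far_points (x p q r : R3 R) :
  4 <= dot (p - q) (p - q) -> 4 <= dot (q - r) (q - r) -> 4 <= dot (p - r) (p - r) ->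
  4 <= dot (x - p) (x - p) + dot (x - q) (x - q) + dot (x - r) (x - r).
Proof.
move=> pq qr pr.
have e1 : dot (p - q) (p - q) + dot (q - r) (q - r) + dot (p - r) (p - r) =
  3 * (dot (x - p) (x - p) + dot (x - q) (x - q) + dot (x - r) (x - r))
  - dot (3 *: x - p - q - r) (3 *: x - p - q - r).
  by rewrite /dot /= /GRing.scale /=; ring.
by have := dot_ge0 (3 *: x - p - q - r); lra.
Qed.

(** A direction common to two cones would give a point of the circle of radius
    [rho] that is nearer to two lines than to the origin; its nearest points on
    these lines and the origin would contradict [three_far_points]. *)
Let trivS : trivIset setT S.
Proof.
apply/trivIsetP => j k _ _ jk; rewrite -subset0 => w [].
rewrite /S; case: asboolP => // Jj; case: asboolP => // Jk.
move=> [_ [w0 Qj]] [_ [_ Qk]].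
have sr := sqn_radial w0; set v := radial w in Qj Qk sr.
have [j1 j2] := near_line aa bb ab (uu j) Qj; have [k1 k2] := near_line aa bb ab (uu k) Qk.
have r2 := @rho_sqr R; rewrite sr r2 in j1 j2 k1 k2.
have gE i t : nearest (e i) (u i) + t *: u i = e i + (t - dot (u i) (e i)) *: u i.
  by rewrite [RHS]nearestE subrKC.
rewrite gE in j1 j2; rewrite gE in k1 k2.
set fj := e j + _ in j1 j2; set fk := e k + _ in k1 k2.
have fj9 : dot fj fj <= 9 by lra.
have fk9 : dot fk fk <= 9 by lra.
have z9 : (0 : R) ^+ 2 <= 9 by rewrite expr0n /=.
have := three_far_points (plane a b v) (apart Jj Jk jk fj9 fk9) (far Jk fk9 z9) (far Jj fj9 z9).
rewrite scale0r subr0 dot_plane_sqn// sr r2; lra.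
Qed.

(** [eta] is [2 * sqrt 3] divided by the area of the disc of radius [rho]. *)
Let eta : R := 3 * Num.sqrt 3 / (2 * pi).

Let eta01 : 0 <= 1 - eta.
Proof.
have p2 := @pi_ge3 R; have /andP[_ s3] := @sqrt3_bounds R.
by rewrite /eta subr_ge0 ler_pdivrMr ?mulr_gt0 ?pi_gt0// mul1r; lra.
Qed.

Let area_odisc : area (odisc rho) = (pi * rho ^+ 2 : R)%:E.
Proof.
rewrite -(@area_disc R true) ?(ltW (@rho_gt0 R))//; congr (area _).
Qed.

(** What the disc loses to line [j] lies in the cone of [j], and is at most the
    fraction [1 - eta] of it; the cones are disjoint. *)
Lemma area_slice_cell : ((2 * Num.sqrt 3)%:E <= area slice_cell)%E.
Proof.
have mc := measurable_slice_cell; have mo := @measurable_odisc R rho.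
have NS j : (area (N j) <= (1 - eta)%:E * area (S j))%E.
  have Sj : S j `<=` odisc rho by rewrite /S; case: asboolP => // _ w [].
  have SE := measureDI area (mS j) (mbelow j); rewrite -/(N j) in SE.
  have [x x0 xE] := @measure_fin _ _ R area _ _ _ (mN j) mo (subset_trans (@subDsetl _ _ _) Sj) area_odisc.
  have [y y0 yE] := @measure_fin _ _ R area _ _ _ (measurableI _ _ (mS j) (mbelow j)) mo
    (subset_trans (@subIsetl _ _ _) Sj) area_odisc.
  have : (eta%:E * area (S j) <= area (S j `&` below (l j) (m j) (c j)))%E.
    rewrite /S; case: asboolP => Jj; last by rewrite set0I measure0 mule0.
    apply: area_cone_below; first exact: c_gt0.
    - exact: (slice_unit aa bb ab (uu j) (far Jj)).
    - exact: (slice_acute nn aa bb ab an bn (uu j) (far Jj)).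
    - exact: (slice_convex nn aa bb ab an bn (uu j) (far Jj)).
  have {}SE : area (S j) = (x + y)%:E.
    by rewrite EFinD -xE -yE; exact: SE.
  rewrite yE xE.
  by rewrite SE -!EFinM !lee_fin; lra.
have NS' : (\esum_(j in [set: I]) area (N j) <= (1 - eta)%:E * area (odisc rho))%E.
  apply: (le_trans (le_esum_mul eta01 _ NS)) => [j|]; first exact: measure_ge0.
  apply: lee_wpmul2l; first by rewrite lee_fin.
  apply: esum_measure_disjoint; [exact: mS | exact: mo | exact: trivS |].
  by move=> j; rewrite /S; case: asboolP => // _ w [].
have cover : odisc rho `\` slice_cell `<=` \bigcup_j N j.
  move=> w [ow nw].
  have [j [Jj Qw]] : exists j, J j /\ 0 <= Q j w.
    apply: contrapT => h; apply: nw; split => // j Jj.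
    by rewrite ltNge; apply/negP => Qw; apply: h; exists j.
  exists j => //; split; last by rewrite /below /= ltNge Qw.
  rewrite /S; case: asboolP => // _; split => //.
  exact: (odisc_cone (c_gt0 Jj) ow Qw).
have := @measure_le_esum R _ _ area I N _ mN (measurableD mo mc) cover.
move=> /le_trans /(_ NS').
have -> : area slice_cell = area (odisc rho `&` slice_cell).
  by congr (area _); apply/seteqP; split => w [] //; split.
have DE := measureDI area mo mc.
have [x x0 xE] := @measure_fin _ _ R area _ _ _ (measurableD mo mc) mo (@subDsetl _ _ _) area_odisc.
have [y y0 yE] := @measure_fin _ _ R area _ _ _ (measurableI _ _ mo mc) mo (@subIsetl _ _ _) area_odisc.
rewrite [X in (X <= _)%E -> _]xE [X in _ -> (_ <= X)%E]yE [X in (_ * X)%E]area_odisc -EFinM !lee_fin => h2.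
have h1 : pi * rho ^+ 2 = x + y.
  by apply: EFin_inj; rewrite EFinD -xE -yE -area_odisc; exact: DE.
have e1 : eta * (pi * rho ^+ 2) = 2 * Num.sqrt 3.
  rewrite rho_sqr /eta; have := pi_gt0 R; move: (pi : R) => p p0; field.
  by rewrite gt_eqF.
lra.
Qed.

End Cell.

(** * Half-infinite cylinders and their cells *)

Section Cylinders.
Context {R : realType}.
Local Notation R2 := (R * R)%type.
Local Notation lam := (@lebesgue_measure R).
Implicit Types p u x y : R3 R.

Lemma cauchy_schwarz x y : dot x y ^+ 2 <= dot x x * dot y y.
Proof.
rewrite -subr_ge0 (_ : _ - _ = (x.1.1 * y.1.2 - x.1.2 * y.1.1) ^+ 2
  + (x.1.1 * y.2 - x.2 * y.1.1) ^+ 2 + (x.1.2 * y.2 - x.2 * y.1.2) ^+ 2).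
  by rewrite !addr_ge0 ?sqr_ge0.
by rewrite /dot; ring.
Qed.

Lemma sqr_triangle x y (r s : R) : 0 <= r -> 0 <= s ->
  dot x x <= r ^+ 2 -> dot y y <= s ^+ 2 -> dot (x + y) (x + y) <= (r + s) ^+ 2.
Proof.
move=> r0 s0 xr ys.
have h : dot x y <= r * s.
  rewrite leNgt; apply/negP => h.
  have : (r * s) ^+ 2 < dot x y ^+ 2 by rewrite ltr_sqr ?nnegrE ?mulr_ge0// (le_trans _ (ltW h))// mulr_ge0.
  rewrite ltNge => /negP; apply; apply: (le_trans (cauchy_schwarz x y)).
  by rewrite exprMn; apply: ler_pM => //; exact: dot_ge0.
rewrite dotDl !dotDr (dotC y x) sqrrD mulr2n; lra.
Qed.

(** The coordinate along the axis and the squared distance to the axis. *)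
Definition axial p u x : R := dot u (x - p).
Definition lateral p u x : R := dot (x - p) (x - p) - axial p u x ^+ 2.

Definition ocyl p u : set (R3 R) := [set x | 0 < axial p u x /\ lateral p u x < 1].
Definition ccyl p u : set (R3 R) := [set x | 0 <= axial p u x /\ lateral p u x <= 1].

Lemma enorm1 u : enorm u = 1 -> dot u u = 1.
Proof. by rewrite /enorm => u1; rewrite -[LHS]sqr_sqrtr ?dot_ge0// u1 expr1n. Qed.

Lemma half_cylinderE p u : dot u u = 1 -> half_cylinder p u = ccyl p u.
Proof.
move=> uu; apply/seteqP; split => x.
  move=> [s [v [s0 vu v1 ->]]].
  have -> : p + s *: u + v = p + (s *: u + v) by rewrite addrA.
  have vv : dot v v <= 1.
    by move: v1; rewrite /enorm -[X in _ <= X -> _]sqrtr1 ler_sqrt// ?ler01.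
  rewrite /ccyl /lateral /axial /= [p + _]addrC addrK.
  rewrite !dotE (dotC u v) vu uu; split; first lra.
  by rewrite expr2; lra.
move=> [s0 l1]; exists (axial p u x), (x - p - axial p u x *: u); split => //.
- rewrite /axial; move: (x - p) => y.
  by rewrite dotDl dotNl dotZl uu (dotC y u); ring.
- rewrite /enorm -[X in _ <= X]sqrtr1 ler_sqrt ?ler01//.
  move: l1; rewrite /lateral /axial; move: (x - p) => y.
  by rewrite dotDl !dotDr !dotNl !dotNr !dotZl !dotZr uu (dotC y u) expr2; lra.
by R3_ring.
Qed.

Lemma continuous_dot (f g : R3 R -> R3 R) :
  continuous f -> continuous g -> continuous (fun x => dot (f x) (g x)).
Proof.
move=> cf cg x.
have c1 (h : R3 R -> R3 R) : continuous h -> (h y).1.1 @[y --> x] --> (h x).1.1.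
  move=> ch; apply: (@continuous_comp _ _ _ (fun y => (h y).1) fst).
    by apply: (@continuous_comp _ _ _ h fst); [exact: ch | exact: cvg_fst].
  exact: cvg_fst.
have c2 (h : R3 R -> R3 R) : continuous h -> (h y).1.2 @[y --> x] --> (h x).1.2.
  move=> ch; apply: (@continuous_comp _ _ _ (fun y => (h y).1) snd).
    by apply: (@continuous_comp _ _ _ h fst); [exact: ch | exact: cvg_fst].
  exact: cvg_snd.
have c3 (h : R3 R -> R3 R) : continuous h -> (h y).2 @[y --> x] --> (h x).2.
  by move=> ch; apply: (@continuous_comp _ _ _ h snd); [exact: ch | exact: cvg_snd].
by apply: cvgD; [apply: cvgD|]; apply: cvgM; auto.
Qed.

Lemma open_ocyl p u : open (ocyl p u).
Proof.
have cs : continuous (fun x : R3 R => x - p).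
  by move=> x; apply: cvgB; [exact: cvg_id | exact: cvg_cst].
have ca : continuous (axial p u).
  by apply: continuous_dot => // x; exact: cvg_cst.
have cl : continuous (lateral p u).
  move=> x; apply: cvgB; first exact: (continuous_dot cs cs).
  apply: (@continuous_comp _ _ _ (axial p u) (fun t : R => t ^+ 2)); first exact: ca.
  exact: exprn_continuous.
apply: openI.
  by apply: (@open_comp _ _ (axial p u) [set t | 0 < t]);
    [move=> x _; exact: ca | exact: open_gt].
by apply: (@open_comp _ _ (lateral p u) [set t | t < 1]);
  [move=> x _; exact: cl | exact: open_lt].
Qed.

Lemma ocyl_interior p u : dot u u = 1 -> ocyl p u `<=` (half_cylinder p u)°.
Proof.
move=> uu; rewrite -open_subsetE; last exact: open_ocyl.
by rewrite half_cylinderE// => x [x0 x1]; split; exact: ltW.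
Qed.

Lemma measurable_sub p : measurable_fun setT (fun x : R3 R => x - p).
Proof.
have mx := @measurable_id _ (R * R * R)%type setT.
have m1 : measurable_fun setT (fun x : R3 R => x.1.1) by
  exact: (measurableT_comp measurable_fst measurable_fst).
have m2 : measurable_fun setT (fun x : R3 R => x.1.2) by
  exact: (measurableT_comp measurable_snd measurable_fst).
have m3 : measurable_fun setT (fun x : R3 R => x.2) by exact: measurable_snd.
by apply: measurable_fun_pair; [apply: measurable_fun_pair|];
  apply: measurable_funB => //; exact: measurable_cst.
Qed.

Lemma measurable_axial p u : measurable_fun setT (axial p u).
Proof. by apply: measurable_dot; [exact: measurable_cst | exact: measurable_sub]. Qed.

Lemma measurable_lateral p u : measurable_fun setT (lateral p u).
Proof.
apply: measurable_funB; first by apply: measurable_dot; exact: measurable_sub.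
by apply: measurable_funX; exact: measurable_axial.
Qed.

Lemma measurable_ocyl p u : measurable (ocyl p u).
Proof.
by apply: measurableI; apply: measurable_set_lt; try exact: measurable_cst;
  [exact: measurable_axial | exact: measurable_lateral].
Qed.

Lemma measurable_ccyl p u : measurable (ccyl p u).
Proof.
by apply: measurableI; apply: measurable_set_le; try exact: measurable_cst;
  [exact: measurable_axial | exact: measurable_lateral].
Qed.

(** The nearest point of the half-line that starts at [p] in direction [u], and
    the squared distance to it. *)
Definition foot p u x : R3 R := p + Num.max 0 (axial p u x) *: u.
Definition ray_dist p u x : R := dot (x - foot p u x) (x - foot p u x).

Lemma ray_distE p u x : ray_dist p u x = dot (x - p) (x - p)
  - 2 * (Num.max 0 (axial p u x) * axial p u x) + Num.max 0 (axial p u x) ^+ 2 * dot u u.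
Proof.
rewrite /ray_dist /foot; move: (Num.max 0 _) => t.
by rewrite /axial /dot /= /GRing.scale /=; ring.
Qed.

Lemma measurable_ray_dist p u : measurable_fun setT (ray_dist p u).
Proof.
have -> : ray_dist p u = (fun x => dot (x - p) (x - p)
  - 2 * (Num.max 0 (axial p u x) * axial p u x) + Num.max 0 (axial p u x) ^+ 2 * dot u u).
  by apply/funext => x; exact: ray_distE.
have mm : measurable_fun setT (fun x => Num.max 0 (axial p u x)).
  by apply: measurable_maxr; [exact: measurable_cst | exact: measurable_axial].
apply: measurable_funD.
  apply: measurable_funB; first by apply: measurable_dot; exact: measurable_sub.
  apply: measurable_funM; first exact: measurable_cst.
  by apply: measurable_funM => //; exact: measurable_axial.
by apply: measurable_funM; [exact: measurable_funX | exact: measurable_cst].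
Qed.

Section FrameFacts.
Variables p a b u : R3 R.
Hypotheses (uu : dot u u = 1) (aa : dot a a = 1) (bb : dot b b = 1)
  (ab : dot a b = 0) (au : dot a u = 0) (bu : dot b u = 0)
  (pf : preserves vol3 (frame p a b u)).
Local Notation F := (frame p a b u).

Lemma frameE w z : F (w, z) = p + z *: u + plane a b w.
Proof. by rewrite /frame /plane /=; R3_ring. Qed.

Lemma frame_axial w z : axial p u (F (w, z)) = z.
Proof.
rewrite /axial frameE /plane.
have -> : p + z *: u + (w.1 *: a + w.2 *: b) - p = z *: u + (w.1 *: a + w.2 *: b).
  by R3_ring.
by rewrite !dotDr !dotZr uu (dotC u a) (dotC u b) au bu; ring.
Qed.

Lemma frame_sub w z : dot (F (w, z) - p) (F (w, z) - p) = sqn w + z ^+ 2.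
Proof.
rewrite frameE /plane.
have -> : p + z *: u + (w.1 *: a + w.2 *: b) - p = z *: u + (w.1 *: a + w.2 *: b).
  by R3_ring.
rewrite !dotDl !dotDr !dotZl !dotZr uu aa bb (dotC u a) (dotC u b) (dotC b a) au bu ab.
by rewrite /sqn; ring.
Qed.

Lemma frame_lateral w z : lateral p u (F (w, z)) = sqn w.
Proof. by rewrite /lateral frame_sub frame_axial addrK. Qed.

Lemma measurable_frame_pre A : measurable A -> measurable (F @^-1` A).
Proof. by move=> mA; apply: measurable_preimage => //; exact: pf.1. Qed.

(** The bounding surface of a cylinder has no volume: in the frame, its side is
    null in each horizontal plane, and its base on each vertical line. *)
Lemma vol_boundary X : measurable X -> vol3 (ccyl p u `&` X) = vol3 (ocyl p u `&` X).
Proof.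
move=> mX; pose side : set (R3 R) := [set x | sqn x.1 = 1].
pose base : set (R3 R) := [set x | x.2 = 0].
have area1 : area [set w : R2 | sqn w = 1] = 0%E.
  have md b' := @measurable_disc R b' 1.
  have aD b' := @area_disc R b' 1 ler01.
  have eD := measureDI area (md false) (md true).
  have [x x0 xE] := @measure_fin _ _ R area _ _ _ (measurableD (md false) (md true)) (md false)
    (@subDsetl _ _ _) (aD false).
  have xp' : (pi * 1 ^+ 2)%:E = (x + pi * 1 ^+ 2)%:E.
    rewrite -(aD false) EFinD -xE -[in RHS](aD true) [LHS]eD; congr (_ + area _)%E.
    apply/seteqP; split => w; first by case.
    by rewrite /disc /lt_or_le /= => h; split => //; exact: ltW.
  have xp : pi * 1 ^+ 2 = x + pi * 1 ^+ 2 by case: xp'.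
  have xz : x = 0 by lra.
  move: xE; rewrite xz => xE; rewrite -[RHS]xE; congr (area _).
  rewrite /disc /lt_or_le /sqn expr1n; apply/seteqP; split => w /=; last first.
    by move=> [h1 /negP]; rewrite -leNgt => h2; apply/eqP; rewrite eq_le h1 h2.
  by move=> ->; split => //; rewrite ltxx.
have msqn : measurable_fun setT (fun x : R3 R => sqn x.1).
  have m1 : measurable_fun setT (fun x : R3 R => x.1.1) by
    exact: (measurableT_comp measurable_fst measurable_fst).
  have m2 : measurable_fun setT (fun x : R3 R => x.1.2) by
    exact: (measurableT_comp measurable_snd measurable_fst).
  by apply: measurable_funD; apply: measurable_funX.
have meq (f : R3 R -> R) (c : R) : measurable_fun setT f -> measurable [set x | f x = c].
  move=> mf; rewrite (_ : [set x | f x = c] = [set x | f x <= c] `&` [set x | c <= f x]).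
    by apply: measurableI; apply: measurable_set_le => //; exact: measurable_cst.
  apply/seteqP; split => x /=; first by move=> ->.
  by move=> [h1 h2]; apply/eqP; rewrite eq_le h1 h2.
have mside : measurable side by exact: meq.
have mbase : measurable base by apply: meq; exact: measurable_snd.
have vside : vol3 side = 0%E.
  rewrite /vol3 prod_measure_ysection//; apply: integral0_eq => z _.
  rewrite -[RHS]area1; congr (area _); apply/seteqP; split => w;
    by rewrite /ysection /= inE.
have vbase : vol3 base = 0%E.
  apply: integral0_eq => w _; rewrite /= -(@lebesgue_measure_set1 R 0).
  by congr (lam _); apply/seteqP; split => z; rewrite /xsection /= inE.
have mO := measurable_ocyl p u; have mC := measurable_ccyl p u.
have mOX := measurableI _ _ mO mX; have mCX := measurableI _ _ mC mX.
rewrite -(pf.2 _ mOX) -(pf.2 _ mCX).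
apply/eqP; rewrite eq_le; apply/andP; split; last first.
  apply: (le_measure vol3); rewrite ?inE; try exact: measurable_frame_pre.
  by move=> x [[/= h1 h2] hX]; split => //; split; exact: ltW.
have sub : F @^-1` (ccyl p u `&` X) `<=` (F @^-1` (ocyl p u `&` X) `|` side) `|` base.
  move=> [w z] [[]]; rewrite frame_axial frame_lateral => z0 w1 hX.
  have [->|zn] := eqVneq z 0; first by right.
  have [we|wn] := eqVneq (sqn w) 1; first by left; right.
  by left; left; split => //; split; rewrite ?frame_axial ?frame_lateral lt_neqAle ?z0 ?w1 andbT// eq_sym.
have mOF := measurable_frame_pre mOX.
apply: le_trans (le_measure vol3 _ _ sub) _; rewrite ?inE.
- exact: measurable_frame_pre.
- by apply: measurableU => //; exact: measurableU.
apply: le_trans (measureU2 vol3 _ mbase) _; first exact: measurableU.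
rewrite [X in (_ + X)%E]vbase adde0.
apply: le_trans (measureU2 vol3 mOF mside) _.
by rewrite [X in (_ + X)%E]vside adde0.
Qed.

End FrameFacts.

End Cylinders.

(** * The volume of a packing in a ball *)

Section Packing.
Context {R : realType} (I : countType).
Local Notation lam := (@lebesgue_measure R).
Variables (p u : I -> R3 R).
Hypotheses (uu : forall i, dot (u i) (u i) = 1)
  (disj : trivIset setT (fun i => ocyl (p i) (u i))).

(** The unit ball around a point of the axis far enough from the end lies in
    the cylinder, so two such points on different axes are at distance [2]. *)
Lemma axes_apart j k (t s : R) : j != k -> 1 <= t -> 1 <= s ->
  4 <= dot (p j + t *: u j - (p k + s *: u k)) (p j + t *: u j - (p k + s *: u k)).
Proof.
have mem i (x h : R3 R) r : 1 <= r -> dot h h < 1 -> x = p i + r *: u i + h ->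
    ocyl (p i) (u i) x.
  move=> r1 h1 ->; rewrite /ocyl /lateral /axial /=.
  have -> : p i + r *: u i + h - p i = r *: u i + h by R3_ring.
  have uh := dot_sqr_le h (uu i).
  have uh1 : -1 < dot (u i) h by rewrite ltNge; apply/negP => hh; nra.
  rewrite dotDl !dotDr !dotZl !dotZr uu (dotC h (u i)); split; first lra.
  move: h1; set d := dot (u i) h => h1.
  have : 0 <= d ^+ 2 by exact: sqr_ge0.
  by rewrite !expr2; lra.
move=> jk t1 s1; rewrite leNgt; apply/negP => h.
set f := p j + t *: u j in h; set f' := p k + s *: u k in h.
pose x := f + 2^-1 *: (f' - f).
have dd : dot (2^-1 *: (f' - f)) (2^-1 *: (f' - f)) < 1.
  by rewrite dotZl dotZr (dot_subC f'); lra.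
have xj : ocyl (p j) (u j) x by apply: (mem j x _ t t1 dd).
have xk : ocyl (p k) (u k) x.
  apply: (mem k x (2^-1 *: (f - f')) s s1).
    by rewrite dotZl dotZr; lra.
  by rewrite /x -/f' ; move: (f) (f') => *; R3_field.
have /trivIsetP := disj; move=> /(_ j k Logic.I Logic.I jk).
by move/seteqP => [/(_ x (conj xj xk))].
Qed.

(** By the triangle inequality [t] is at least [2] in absolute value, and [t > 0]
    because the half-line approaches the origin. This puts the nearby pieces of
    the axes within the scope of [axes_apart]. *)
Lemma param_ge1 (e v : R3 R) t0 t : dot v v = 1 -> 25 < dot e e -> 0 <= t0 ->
  dot (e + t0 *: v) (e + t0 *: v) <= 9 -> dot (e + t *: v) (e + t *: v) <= 9 -> 1 <= t.
Proof.
move=> vv ee t00.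
rewrite !dotDl !dotDr !dotZl !dotZr vv (dotC v e); set d := dot e v => h0 h.
rewrite leNgt; apply/negP => t1; have [tn|tp] := ltP t 0.
  have : 2 * (t * d) < 0 by have := sqr_ge0 t; rewrite expr2; lra.
  have : 2 * (t0 * d) < 0 by have := sqr_ge0 t0; rewrite expr2; lra.
  by nra.
have := dot_ge0 (e + (2 * t) *: v); rewrite !dotDl !dotDr !dotZl !dotZr vv (dotC v e) -/d.
have : t * t <= 1 by nra.
by lra.
Qed.

(** The Dirichlet cell of axis [i]; the bound by [rho] keeps it close to the
    cylinder. *)
Definition vcell i : set (R3 R) := [set x | ray_dist (p i) (u i) x < rho ^+ 2 /\
  forall j, j != i -> ray_dist (p i) (u i) x < ray_dist (p j) (u j) x].

(** With radius [8], a point of a cylinder outside all these balls has a foot on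
    the axis that is farther than [5] from all ends. *)
Definition near_end k : set (R3 R) := [set x | dot (x - p k) (x - p k) <= 8 ^+ 2].

Lemma measurable_vcell i : measurable (vcell i).
Proof.
rewrite (_ : vcell i = [set x | ray_dist (p i) (u i) x < rho ^+ 2] `&`
  \bigcap_(j in [set j | j != i]) [set x | ray_dist (p i) (u i) x < ray_dist (p j) (u j) x]).
  apply: measurableI.
    by apply: measurable_set_lt; [exact: measurable_ray_dist | exact: measurable_cst].
  apply: countable_bigcap_measurable => j.
  by apply: measurable_set_lt; exact: measurable_ray_dist.
by apply/seteqP; split => x [].
Qed.

Lemma trivIset_vcell : trivIset setT vcell.
Proof.
apply/trivIsetP => i j _ _ ij; rewrite -subset0 => x [[_ h1] [_ h2]].
have := h1 j; rewrite eq_sym ij => /(_ isT) h3.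
by have := lt_trans h3 (h2 i ij); rewrite ltxx.
Qed.

Lemma measurable_near_end k : measurable (near_end k).
Proof.
apply: measurable_set_le; last exact: measurable_cst.
by apply: measurable_dot; exact: measurable_sub.
Qed.

Definition ends : set (R3 R) := \bigcup_k near_end k.

Lemma measurable_ends : measurable ends.
Proof. by apply: countable_bigcupT_measurable => // k; exact: measurable_near_end. Qed.

Definition dens : R := pi / (2 * Num.sqrt 3).

Lemma dens_gt0 : 0 < dens.
Proof. by rewrite divr_gt0 ?pi_gt0// mulr_gt0// sqrt3_gt0. Qed.

(** Away from the ends, a cross-section of the cylinder has area at most [pi],
    and the one of the cell contains a [slice_cell]. Both lie within [rho] of the
    axis, hence the ball of radius [r + 3]. *)
Lemma vol_cylinder_cell i (r : R) : 0 <= r ->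
  (vol3 (ocyl (p i) (u i) `&` eball r `\` ends) <=
   dens%:E * vol3 (vcell i `&` eball (r + 3)))%E.
Proof.
move=> r0; have r3 : 0 <= r + 3 by lra.
have [a [b [[aa bb ab au bu] pf]]] := exists_frame (p i) (uu i).
have mA : measurable (ocyl (p i) (u i) `&` eball r `\` ends).
  apply: measurableD; last exact: measurable_ends.
  by apply: measurableI; [exact: measurable_ocyl | exact: measurable_eball].
have mB : measurable (vcell i `&` eball (r + 3)).
  by apply: measurableI; [exact: measurable_vcell | exact: measurable_eball].
rewrite -(pf.2 _ mA) -(pf.2 _ mB).
set F := frame _ _ _ _ in pf *.
have mFA : measurable (F @^-1` (ocyl (p i) (u i) `&` eball r `\` ends)).
  by apply: measurable_preimage => //; exact: pf.1.
have mFB : measurable (F @^-1` (vcell i `&` eball (r + 3))).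
  by apply: measurable_preimage => //; exact: pf.1.
apply: (@le_prod_ysection R _ _ _ _ area lam) => //; first exact/ltW/dens_gt0.
move=> z.
have [->|/set0P[w0]] := eqVneq (ysection (F @^-1` (ocyl (p i) (u i) `&` eball r `\` ends)) z) set0.
  by rewrite measure0 mule_ge0// lee_fin ltW// dens_gt0.
rewrite /ysection /= inE => -[[[z0 w01] xr] xends].
rewrite frame_axial// in z0; rewrite frame_lateral// in w01.
pose c := p i + z *: u i.
have FE w : F (w, z) = c + plane a b w by exact: frameE.
have good k : 25 < dot (p k - c) (p k - c).
  rewrite ltNge; apply/negP => h; apply: xends; exists k => //; rewrite /near_end /=.
  have -> : F (w0, z) - p k = plane a b w0 + (c - p k) by rewrite FE; R3_ring.
  have := sum_sqr_le (plane a b w0) (c - p k).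
  by rewrite dot_plane_sqn// (dot_subC c) expr2; lra.
have z5 : 5 < z.
  have := good i; have -> : p i - c = (- z) *: u i by rewrite /c; R3_ring.
  rewrite dotZl dotZr uu; have : 0 < z by []; nra.
pose e j := p j - c.
pose J := [set j | j != i /\ exists2 t, 0 <= t & dot (e j + t *: u j) (e j + t *: u j) < 16 / 3].
have late j t : J j -> dot (e j + t *: u j) (e j + t *: u j) <= 9 -> 1 <= t.
  by move=> [_ [t0 t00 ht0]]; apply: (param_ge1 (uu j) (good j) t00); lra.
have far j : J j -> forall t s, dot (e j + t *: u j) (e j + t *: u j) <= 9 -> s ^+ 2 <= 9 ->
    4 <= dot (e j + t *: u j - s *: u i) (e j + t *: u j - s *: u i).
  move=> Jj t s /(late _ _ Jj) t1 s9.
  have -> : e j + t *: u j - s *: u i = p j + t *: u j - (p i + (z + s) *: u i).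
    by rewrite /e /c; R3_ring.
  apply: axes_apart => //; first by case: Jj.
  by rewrite expr2 in s9; nra.
have apart j k : J j -> J k -> j != k -> forall t s,
    dot (e j + t *: u j) (e j + t *: u j) <= 9 ->
    dot (e k + s *: u k) (e k + s *: u k) <= 9 ->
    4 <= dot (e j + t *: u j - (e k + s *: u k)) (e j + t *: u j - (e k + s *: u k)).
  move=> Jj Jk jk t s /(late _ _ Jj) t1 /(late _ _ Jk) s1.
  have -> : e j + t *: u j - (e k + s *: u k) = p j + t *: u j - (p k + s *: u k).
    by rewrite /e /c; R3_ring.
  exact: axes_apart.
have cell := area_slice_cell (uu i) aa bb ab au bu uu far apart.
have sub : slice_cell a b e u J `<=` ysection (F @^-1` (vcell i `&` eball (r + 3))) z.
  move=> w [ow Qw]; rewrite /ysection /= inE.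
  have rdi : ray_dist (p i) (u i) (F (w, z)) = sqn w.
    rewrite ray_distE frame_axial// frame_sub// uu max_r; last by rewrite ltW.
    by rewrite !expr2; ring.
  have r2 := @rho_sqr R; rewrite /odisc /= r2 in ow.
  split.
    split; first by rewrite rdi r2.
    move=> j ji; rewrite rdi ltNge; apply/negP; rewrite /ray_dist /foot.
    have : 0 <= Num.max 0 (axial (p j) (u j) (F (w, z))) by rewrite le_max lexx.
    move: (Num.max 0 _) => t t0 h.
    have h' : dot (plane a b w - (e j + t *: u j)) (plane a b w - (e j + t *: u j)) <= sqn w.
      move: h; congr (dot _ _ <= _); rewrite FE /e; R3_ring.
    have Jj : J j.
      split => //; exists t => //.
      have := sum_sqr_le (e j + t *: u j - plane a b w) (plane a b w).
      by rewrite subrK dot_plane_sqn// (dot_subC (e j + t *: u j)); lra.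
    have := Qw j Jj; move: h'; rewrite nearestE dist_line//.
    have := sqr_ge0 (dot (u j) (plane a b w) - (dot (u j) (e j) + t)); lra.
  rewrite eballE//=.
  have -> : F (w, z) = F (w0, z) + (plane a b w - plane a b w0) by rewrite !FE; R3_ring.
  apply: sqr_triangle => //; first by rewrite eballE in xr.
  have -> : plane a b w - plane a b w0 = plane a b w + plane a b (- w0.1, - w0.2).
    by rewrite /plane /=; R3_ring.
  apply: (le_trans (sum_sqr_le _ _)); rewrite !dot_plane_sqn//.
  have -> : sqn (- w0.1, - w0.2) = sqn w0 by rewrite /sqn /= !sqrrN.
  by rewrite expr2; lra.
have my1 := measurable_ysection z mFA; have my2 := measurable_ysection z mFB.
apply: (@le_trans _ _ (pi * 1 ^+ 2)%:E).
  rewrite -(@area_disc R true 1 ler01); apply: (le_measure area); rewrite ?inE.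
  - exact: my1.
  - exact: measurable_disc.
  move=> w; rewrite /ysection /= inE => -[[[_ w1] _] _].
  by rewrite frame_lateral// in w1; rewrite /disc /lt_or_le /= expr1n.
apply: (@le_trans _ _ (dens%:E * (2 * Num.sqrt 3)%:E)%E).
  have s3 : 2 * Num.sqrt 3 != 0 :> R by rewrite lt0r_neq0// mulr_gt0// sqrt3_gt0.
  by rewrite -EFinM lee_fin /dens (divfK s3) expr1n mulr1.
apply: lee_wpmul2l; first by rewrite lee_fin ltW// dens_gt0.
apply: (le_trans cell); apply: (le_measure area); rewrite ?inE => //.
exact: measurable_slice_cell.
Qed.

(** Each end within distance [r + 8] of the origin pays for its ball by a piece
    of length [r + 8] of its own cylinder, so the ends count for [O(r ^ 2)]. *)
Lemma vol_near_end k (r : R) : 0 <= r ->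
  (vol3 (near_end k `&` eball r) <=
   (683 / (r + 8))%:E * vol3 (ocyl (p k) (u k) `&` eball (3 * (r + 8))))%E.
Proof.
move=> r0; set s := r + 8; have s8 : 8 <= s by rewrite /s; lra.
have s0 : 0 < s by lra.
(* [683] exceeds [4 / 3 * 8 ^ 3]. *)
have k0 : 0 <= 683 / s by apply: divr_ge0; [exact: ler0n | exact: ltW].
have mN := measurable_near_end k; have mB := measurable_eball r0.
have ms : measurable (eball (3 * s)) by apply: measurable_eball; lra.
have mO := measurable_ocyl (p k) (u k).
have [|/set0P[x [/= xk xr]]] := eqVneq (near_end k `&` eball r) set0.
  by move=> ->; rewrite measure0 mule_ge0// lee_fin.
have pk : dot (p k) (p k) <= s ^+ 2.
  have -> : p k = x + (p k - x) by R3_ring.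
  apply: sqr_triangle => //; first by rewrite eballE in xr.
  by rewrite dot_subC.
have [a [b [[aa bb ab au bu] pf]]] := exists_frame (p k) (uu k).
pose box : set (R3 R) := disc true 1 `*` `]0, s[%classic.
have vbox : vol3 box = (pi * s)%:E.
  transitivity (area (disc true 1) * lam `]0%R, s[%classic)%E.
    by apply: (@product_measure1E _ _ _ _ R area lam) => //; exact: measurable_disc.
  rewrite area_disc// lebesgue_measure_itv /= lte_fin s0.
  by rewrite -EFinB -EFinM expr1n mulr1 subr0.
have le_box : ((pi * s)%:E <= vol3 (ocyl (p k) (u k) `&` eball (3 * s)))%E.
  have mOs := measurableI _ _ mO ms.
  rewrite -vbox -(pf.2 _ mOs); apply: (le_measure vol3); rewrite ?inE.
  - by apply: measurableX => //; exact: measurable_disc.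
  - by apply: measurable_preimage => //; exact: pf.1.
  move=> [w z] [/= w1]; rewrite in_itv /= => /andP[z0 zs].
  rewrite /disc /lt_or_le /= expr1n in w1; split.
    by split; rewrite ?frame_axial ?frame_lateral.
  rewrite eballE /=; last lra.
  have -> : frame (p k) a b (u k) (w, z) = p k + (frame (p k) a b (u k) (w, z) - p k) by R3_ring.
  have -> : 3 * s = s + 2 * s by ring.
  apply: sqr_triangle => //; [lra | lra |].
  rewrite frame_sub// /sqn; have : z ^+ 2 <= s ^+ 2 by rewrite ler_sqr ?nnegrE ?ltW.
  by rewrite exprMn; nra.
apply: (@le_trans _ _ ((683 / s)%:E * (pi * s)%:E)%E); last first.
  by apply: lee_wpmul2l; rewrite ?lee_fin.
have vN : vol3 (near_end k) = (4 / 3 * pi * 8 ^+ 3)%:E.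
  have p8 : 0 < 8 :> R by rewrite ltr0n.
  rewrite -(vol_eball p8).
  have m8 : measurable (eball 8 : set (R3 R)) by exact: (measurable_eball (ltW p8)).
  rewrite -((preserves_vol_shift (- p k)).2 _ m8); congr (vol3 _).
  have e y : dot (y - p k) (y - p k) = dot (- p k + y) (- p k + y).
    by rewrite /dot /=; ring.
  by apply/seteqP; split => y; rewrite /preimage /mkset eballE// /near_end /mkset e.
have le_N : (vol3 (near_end k `&` eball r) <= vol3 (near_end k))%E.
  have mNr := measurableI _ _ mN mB.
  by apply: (le_measure vol3); rewrite ?inE //; exact: subIsetl.
apply: (le_trans le_N); rewrite vN -EFinM lee_fin; have := pi_gt0 R; move: (pi : R) => q q0.
rewrite (_ : 683 / s * (q * s) = 683 * q); last by field; rewrite gt_eqF.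
by rewrite -subr_ge0 (_ : _ - _ = q / 3); [lra | field].
Qed.

(** The second term comes from [vol_near_end]: [18441] is [683 * 3 ^ 3]. *)
Lemma vol_cylinders (r : R) : 0 < r ->
  (\esum_(i in [set: I]) vol3 (ocyl (p i) (u i) `&` eball r) <=
   (4 / 3 * pi * (dens * (r + 3) ^+ 3 + 18441 * (r + 8) ^+ 2))%:E)%E.
Proof.
move=> r0; have r0' := ltW r0.
have mO i := measurable_ocyl (p i) (u i).
have mr := measurable_eball r0'; have mE := measurable_ends.
have mOr i : measurable (ocyl (p i) (u i) `&` eball r) by exact: measurableI.
have d0 := dens_gt0.
apply: (@le_trans _ _ (\esum_(i in [set: I])
    (vol3 (ocyl (p i) (u i) `&` eball r `\` ends) +
     vol3 (ocyl (p i) (u i) `&` (eball r `&` ends))))%E).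
  apply: le_esum => i _; rewrite setIA.
  by rewrite le_eqVlt; apply/orP; left; apply/eqP; exact: (measureDI vol3 (mOr i) mE).
rewrite esumD; [|by move=> i _; exact: measure_ge0..].
have cells : (\esum_(i in [set: I]) vol3 (ocyl (p i) (u i) `&` eball r `\` ends) <=
    dens%:E * (4 / 3 * pi * (r + 3) ^+ 3)%:E)%E.
  apply: (le_trans (@le_esum_mul R I dens _
    (fun i => vol3 (vcell i `&` eball (r + 3))) (ltW d0) _ _)).
  - by move=> i; exact: measure_ge0.
  - by move=> i; exact: vol_cylinder_cell.
  rewrite -(@vol_eball R (r + 3)); last lra.
  apply: lee_wpmul2l; first by rewrite lee_fin ltW.
  have m3 : measurable (eball (r + 3) : set (R3 R)) by apply: measurable_eball; lra.
  apply: (@esum_measure_disjoint R _ _ vol3) => //.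
  - by move=> i; apply: measurableI => //; exact: measurable_vcell.
  - exact: trivIset_setIr trivIset_vcell.
have bad : (\esum_(i in [set: I]) vol3 (ocyl (p i) (u i) `&` (eball r `&` ends)) <=
    (683 / (r + 8))%:E * (4 / 3 * pi * (3 * (r + 8)) ^+ 3)%:E)%E.
  have mre : measurable (eball r `&` ends) by exact: measurableI.
  have k0 : 0 <= 683 / (r + 8) by apply: divr_ge0; [exact: ler0n | lra].
  apply: (@le_trans _ _ (vol3 (eball r `&` ends))).
    apply: (@esum_measure_disjoint R _ _ vol3) => //.
    - by move=> i; exact: (measurableI _ _ (mO i) mre).
    - exact: trivIset_setIr disj.
  apply: (@le_trans _ _ (\esum_(k in [set: I]) vol3 (near_end k `&` eball r))%E).
    apply: (@measure_le_esum R _ _ vol3) => //.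
    - by move=> k; apply: measurableI => //; exact: measurable_near_end.
    - by move=> x [xr [k _ xk]]; exists k.
  apply: (le_trans (@le_esum_mul R I (683 / (r + 8)) _
    (fun k => vol3 (ocyl (p k) (u k) `&` eball (3 * (r + 8)))) _ _ _)).
  - exact: k0.
  - by move=> k; exact: measure_ge0.
  - by move=> k; exact: vol_near_end.
  rewrite -(@vol_eball R (3 * (r + 8))); last lra.
  apply: lee_wpmul2l; first by rewrite lee_fin; exact: k0.
  have m3 : measurable (eball (3 * (r + 8)) : set (R3 R)) by apply: measurable_eball; lra.
  apply: (@esum_measure_disjoint R _ _ vol3) => //.
  - by move=> i; exact: (measurableI _ _ (mO i) m3).
  - exact: trivIset_setIr disj.
apply: (le_trans (leeD cells bad)).
rewrite -!EFinM -EFinD lee_fin le_eqVlt; apply/orP; left; apply/eqP.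
move: (pi : R) (dens) => q d; field; rewrite gt_eqF//; lra.
Qed.

End Packing.

(** * From volumes in balls to upper densities *)

Section Density.
Context {R : realType}.
Implicit Types (f : R -> \bar R).

Lemma limf_esup_pinfty_le f (d K : R) : 0 <= K ->
  (forall r : R, 1 <= r -> (f r <= (d + K / r)%:E)%E) ->
  (limf_esup f (pinfty_nbhs R) <= d%:E)%E.
Proof.
move=> K0 fd; apply/lee_addgt0Pr => e e0.
pose M := Num.max 1 (K / e).
apply: (@le_trans _ _ (ereal_sup (f @` [set r | M < r]))).
  apply: ereal_inf_lbound; exists [set r | M < r] => //.
  by exists M; split; rewrite ?num_real.
apply: ge_ereal_sup => _ [r /= Mr <-].
have [r1 rK] : 1 < r /\ K / e < r.
  by move: Mr; rewrite gt_max => /andP[].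
apply: (le_trans (fd r (ltW r1))); rewrite -EFinD lee_fin lerD2l.
rewrite ler_pdivrMr; last lra.
by move: rK; rewrite ltr_pdivrMr// mulrC => /ltW.
Qed.

Lemma limf_esup_pinfty_ge f (d K : R) : 0 <= K ->
  (forall r : R, 4 < r -> ((d - K / r)%:E <= f r)%E) ->
  (d%:E <= limf_esup f (pinfty_nbhs R))%E.
Proof.
move=> K0 fd; apply: le_ereal_inf_tmp => _ [V [M [_ MV]] <-].
apply/lee_addgt0Pr => e e0.
pose r := Num.max 4 (Num.max M (K / e)) + 1.
have [r4 rM rK] : [/\ 4 < r, M < r & K / e < r].
  rewrite /r; set a := Num.max M _; set b := Num.max 4 _.
  have h1 : 4 <= b by rewrite le_max lexx.
  have h2 : a <= b by rewrite le_max lexx orbT.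
  have h3 : M <= a by rewrite le_max lexx.
  have h4 : K / e <= a by rewrite le_max lexx orbT.
  by split; lra.
apply: (@le_trans _ _ (f r + e%:E)%E); last first.
  by apply: leeD2r; apply: ereal_sup_ubound; exists r => //; exact: MV.
apply: (@le_trans _ _ ((d - K / r)%:E + e%:E)%E); last first.
  by apply: leeD2r; exact: fd.
rewrite -EFinD lee_fin.
have : K / r <= e.
  rewrite ler_pdivrMr; last lra.
  by move: rK; rewrite ltr_pdivrMr// mulrC => /ltW.
by lra.
Qed.

Definition ball_vol (r : R) : R := 4 / 3 * pi * r ^+ 3.

Lemma ball_vol_gt0 r : 0 < r -> 0 < ball_vol r.
Proof. by move=> r0; rewrite /ball_vol !mulr_gt0 ?exprn_gt0 ?pi_gt0//; lra. Qed.

Lemma div_vol_eball (r : R) (x : \bar R) : 0 < r ->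
  (x / vol (eball r) = (ball_vol r)^-1%:E * x)%E.
Proof.
move=> r0; rewrite volE vol_eball// -/(ball_vol r) muleC inver.
by rewrite gt_eqF// ball_vol_gt0.
Qed.

Lemma upper_density_le (I : countType) (C : I -> set (R3 R)) : packing C ->
  (upper_density C <= (dens : R)%:E)%E.
Proof.
move=> [cyl tri].
have cyl' i : exists pu : R3 R * R3 R, enorm pu.2 = 1 /\ C i = half_cylinder pu.1 pu.2.
  by have [p [u pu]] := cyl i; exists (p, u).
have [f fP] := boolp.choice cyl'.
pose p i := (f i).1; pose u i := (f i).2.
have {cyl'} pu i : enorm (u i) = 1 /\ C i = half_cylinder (p i) (u i) by exact: fP.
have uu i : dot (u i) (u i) = 1 by apply: enorm1; case: (pu i).
have CE i : C i = ccyl (p i) (u i) by rewrite -half_cylinderE//; case: (pu i).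
have disj : trivIset setT (fun i => ocyl (p i) (u i)).
  apply/trivIsetP => i j _ _ ij; rewrite -subset0 => x [xi xj].
  move/trivIsetP : tri => /(_ i j Logic.I Logic.I ij).
  move=> /seteqP[/(_ x) + _]; apply; split.
    by case: (pu i) => _ ->; exact: ocyl_interior.
  by case: (pu j) => _ ->; exact: ocyl_interior.
have d0 := @dens_gt0 R.
(* For [1 <= r], [(r + 3) ^ 3 <= r ^ 3 + 63 * r ^ 2] and [(r + 8) ^ 2 <= 81 * r ^ 2]. *)
apply: (@limf_esup_pinfty_le _ _ (63 * dens + 18441 * 81)); first lra.
move=> r r1; have r0 : 0 < r by lra.
have b0 := ball_vol_gt0 r0.
apply: (@le_trans _ _ ((ball_vol r)^-1%:E *
    \esum_(i in [set: I]) vol3 (ocyl (p i) (u i) `&` eball r))%E).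
  apply: le_esum_mul => [||i]; first by rewrite invr_ge0 ltW.
    by move=> i; exact: measure_ge0.
  rewrite div_vol_eball// volE CE.
  have [a [b [[aa bb ab au bu] pf]]] := exists_frame (p i) (uu i).
  by rewrite (vol_boundary (uu i) aa bb ab au bu pf)//; apply: measurable_eball; exact: ltW.
apply: (@le_trans _ _ ((ball_vol r)^-1%:E *
  (4 / 3 * pi * (dens * (r + 3) ^+ 3 + 18441 * (r + 8) ^+ 2))%:E)%E).
  by apply: lee_wpmul2l; [rewrite lee_fin invr_ge0 ltW | exact: vol_cylinders].
rewrite -EFinM lee_fin mulrC ler_pdivrMr// /ball_vol.
rewrite (_ : (dens + _ / r) * _ = 4 / 3 * pi *
   (dens * r ^+ 3 + (63 * dens + 18441 * 81) * r ^+ 2)); last first.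
  by move: (pi : R) => q; field; rewrite gt_eqF.
have p0 := pi_gt0 R.
rewrite ler_pM2l; last by rewrite mulr_gt0//; lra.
have h1 : (r + 3) ^+ 3 <= r ^+ 3 + 63 * r ^+ 2.
  rewrite -subr_ge0 (_ : _ - _ = 27 * (r * (r - 1)) + 27 * ((r - 1) * (r + 1))); last by ring.
  by rewrite addr_ge0// mulr_ge0// mulr_ge0//; lra.
have h2 : (r + 8) ^+ 2 <= 81 * r ^+ 2.
  rewrite -subr_ge0 (_ : _ - _ = (r - 1) * (80 * r + 64)); last by ring.
  by rewrite mulr_ge0//; lra.
move: (dens) d0 => d d0.
have h3 : d * (r + 3) ^+ 3 <= d * (r ^+ 3 + 63 * r ^+ 2) by apply: ler_wpM2l => //; exact: ltW.
move: h2 h3; clear.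
set x := (r + 3) ^+ 3; set y := r ^+ 3; set z := r ^+ 2; set t := (r + 8) ^+ 2.
move: x y z t => x y z t; lra.
Qed.

End Density.

(** * The hexagonal packing *)

Section Hexagonal.
Context {R : realType}.
Local Notation R2 := (R * R)%type.
Local Notation lam := (@lebesgue_measure R).
Implicit Types (m n : int) (b : bool) (p u x : R3 R).

Lemma interior_ray (A : set (R3 R)) x (d : R3 R) : A° x -> exists2 t : R, 0 < t & A (x + t *: d).
Proof.
move=> Ax; have c : (x + t *: d) @[t --> (0 : R)] --> x + 0 *: d.
  by apply: cvgD; [exact: cvg_cst | apply: cvgZr_tmp; exact: cvg_id].
rewrite scale0r addr0 in c.
have /nbhs_ballP[e /= e0 sub] := c _ Ax.
exists (e / 2); first by rewrite divr_gt0.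
apply: sub; rewrite /ball /= sub0r normrN gtr0_norm ?divr_gt0//; lra.
Qed.

(** From a point of the bounding surface one leaves the cylinder immediately,
    backwards along the axis or away from the axis. *)
Lemma interior_ocyl p u : dot u u = 1 -> (half_cylinder p u)° `<=` ocyl p u.
Proof.
move=> uu x; rewrite half_cylinderE// => xi; split.
  have [t t0 [+ _]] := interior_ray (- u) xi.
  have -> : x + t *: - u = p + (x - p) - t *: u by R3_ring.
  rewrite /axial; have -> : p + (x - p) - t *: u - p = (x - p) - t *: u by R3_ring.
  by rewrite dotDr dotNr dotZr uu; lra.
have [t t0 [_ +]] := interior_ray (x - p) xi.
rewrite /lateral /axial; have -> : x + t *: (x - p) - p = (1 + t) *: (x - p) by R3_ring.
rewrite !dotZl !dotZr; set L := dot _ _; set a := dot u _ => h.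
rewrite ltNge; apply/negP => L1.
have : (1 + t) * ((1 + t) * L) - ((1 + t) * a) ^+ 2 = (1 + t) ^+ 2 * (L - a ^+ 2) by ring.
by nra.
Qed.

Definition lattice m n : R2 := ((2 * m + n)%:~R, Num.sqrt 3 * n%:~R).

Lemma lattice_apart m n m' n' : (m, n) != (m', n') ->
  4 <= sqn ((lattice m n).1 - (lattice m' n').1, (lattice m n).2 - (lattice m' n').2).
Proof.
move=> ne; pose a := m - m'; pose c := n - n'.
have -> : sqn ((lattice m n).1 - (lattice m' n').1, (lattice m n).2 - (lattice m' n').2)
    = 4 * (a ^+ 2 + a * c + c ^+ 2)%:~R.
  transitivity (((2 * m + n)%:~R - (2 * m' + n')%:~R) ^+ 2
     + Num.sqrt 3 ^+ 2 * (n%:~R - n'%:~R) ^+ 2 : R).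
    by rewrite /sqn /=; ring.
  by rewrite sqrt3_sqr /a /c !intrD !intrM !intrB; ring.
rewrite -[leLHS]mulr1 ler_pM2l// (_ : 1 = 1%:~R :> R)// ler_int.
have e : 4 * (a ^+ 2 + a * c + c ^+ 2) = (2 * a + c) ^+ 2 + 3 * c ^+ 2 by ring.
have h1 := sqr_ge0 (2 * a + c); have h2 := sqr_ge0 c.
have [c0|c0] := eqVneq c 0.
  have a0 : a != 0.
    apply: contra_neq ne => a0; congr (_, _); apply/eqP; rewrite -subr_eq0 -/a -/c; exact/eqP.
  rewrite c0 mulr0 expr0n /= !addr0 -gtz0_ge1.
  by rewrite lt_neqAle sqr_ge0 eq_sym sqrf_eq0 a0.
have : 0 < c ^+ 2 by rewrite lt_neqAle sqr_ge0 eq_sym sqrf_eq0 c0.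
by rewrite -gtz0_ge1; lra.
Qed.

(** Cylinders that point up serve one half-space, those that point down the
    other one. *)
Definition hex_base m n : R3 R := (lattice m n, 0).
Definition hex_dir b : R3 R := (0, 0, if b then 1 else -1).

Lemma hex_dir_unit b : dot (hex_dir b) (hex_dir b) = 1.
Proof. by rewrite /dot; case: b => /=; ring. Qed.

Lemma hex_axial m n b x : axial (hex_base m n) (hex_dir b) x = if b then x.2 else - x.2.
Proof. by rewrite /axial /dot; case: b => /=; ring. Qed.

Lemma hex_lateral m n b x : lateral (hex_base m n) (hex_dir b) x =
  sqn (x.1.1 - (lattice m n).1, x.1.2 - (lattice m n).2).
Proof.
rewrite /lateral hex_axial /dot /sqn /hex_base; move: (lattice m n) => [s t].
by case: b => /=; ring.
Qed.

Definition hex_packing (i : int * int * bool) : set (R3 R) :=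
  half_cylinder (hex_base i.1.1 i.1.2) (hex_dir i.2).

Lemma packing_hex : packing hex_packing.
Proof.
split.
  move=> [[m n] b]; exists (hex_base m n), (hex_dir b); split => //.
  by rewrite /enorm hex_dir_unit sqrtr1.
apply/trivIsetP => -[[m n] b] [[m' n'] b'] _ _ ne; rewrite -subset0 => x [].
move=> /(interior_ocyl (hex_dir_unit b)) [/= + +].
rewrite hex_axial hex_lateral => z1 l1.
move=> /(interior_ocyl (hex_dir_unit b')) [/= + +].
rewrite hex_axial hex_lateral => z2 l2.
have bb : b = b'.
  by case: b b' z1 z2 {ne} => -[] // z1 z2; exfalso; lra.
have ne' : (m, n) != (m', n').
  by move: ne; rewrite !xpair_eqE bb eqxx andbT.
have := lattice_apart ne'; move: l1 l2; rewrite /sqn /=.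
set p1 := (2 * m + n)%:~R; set q1 := (2 * m' + n')%:~R.
set p2 := _ * n%:~R; set q2 := _ * n'%:~R.
have := sqr_ge0 (x.1.1 - p1 + (x.1.1 - q1)); have := sqr_ge0 (x.1.2 - p2 + (x.1.2 - q2)).
rewrite !expr2; lra.
Qed.

(** Rows of these rectangles, each row shifted by half a rectangle, tile the
    plane; this is a simpler fundamental domain of the lattice than the hexagon. *)
Definition brick : set R2 := `[-1, 1[%classic `*` `[0, Num.sqrt 3[%classic.

Lemma area_brick : area brick = (2 * Num.sqrt 3)%:E.
Proof.
transitivity (lam `[(-1)%R, 1%R[%classic * lam `[0%R, (Num.sqrt 3)%R[%classic)%E.
  by apply: (@product_measure1E _ _ _ _ R lam lam).
have N11 : -1 < 1 :> R by lra.
rewrite !lebesgue_measure_itv /= !lte_fin N11 sqrt3_gt0.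
by rewrite -!EFinB -EFinM; congr (_%:E); ring.
Qed.

Definition hex_cell (i : int * int * bool) : set (R3 R) :=
  [set x | brick (x.1.1 - (lattice i.1.1 i.1.2).1, x.1.2 - (lattice i.1.1 i.1.2).2)
    /\ if i.2 then 0 <= x.2 else x.2 < 0].

Lemma hex_cell_cover x : exists i, hex_cell i x.
Proof.
case: x => -[x y] z; pose n := Num.floor (y / Num.sqrt 3).
pose m := Num.floor ((x + 1 - n%:~R) / 2).
exists (m, n, 0 <= z); split => /=; last by case: leP.
have s0 := @sqrt3_gt0 R.
have /andP[n1 n2] := floor_itv (y / Num.sqrt 3).
have /andP[m1 m2] := floor_itv ((x + 1 - n%:~R) / 2).
rewrite -/n intrD in n1 n2; rewrite -/m intrD in m1 m2.
rewrite ler_pdivlMr// in n1; rewrite ltr_pdivrMr// in n2.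
by rewrite /brick; split => /=; rewrite in_itv /= ?intrD ?intrM; apply/andP; split; lra.
Qed.

Lemma measurable_shift2 (v : R2) : measurable_fun setT (fun x : R3 R => (x.1.1 - v.1, x.1.2 - v.2)).
Proof.
have m1 : measurable_fun setT (fun x : R3 R => x.1.1) by
  exact: (measurableT_comp measurable_fst measurable_fst).
have m2 : measurable_fun setT (fun x : R3 R => x.1.2) by
  exact: (measurableT_comp measurable_snd measurable_fst).
by apply: measurable_fun_pair; apply: measurable_funB => //; exact: measurable_cst.
Qed.

Lemma measurable_brick : measurable brick.
Proof. by apply: measurableX; exact: measurable_itv. Qed.

Lemma measurable_hex_cell i : measurable (hex_cell i).
Proof.
apply: measurableI.
  by apply: measurable_preimage; [exact: measurable_shift2 | exact: measurable_brick].
have mz : measurable_fun setT (fun x : R3 R => x.2) by exact: measurable_snd.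
by case: i.2; [apply: measurable_set_le | apply: measurable_set_lt] => //;
  exact: measurable_cst.
Qed.

Lemma area_shift (A : set R2) (v : R2) : measurable A ->
  area [set w : R2 | A (w.1 - v.1, w.2 - v.2)] = area A.
Proof. by move=> mA; exact: ((preserves_shift2 (- v.1, - v.2)).2 _ mA). Qed.

(** In a horizontal plane, a point of the disc and a point of its rectangle are
    at distance at most [4], so the disc is in the ball of radius [r] as soon as
    the rectangle meets the ball of radius [r - 4]. *)
Lemma vol_hex_cell i (r : R) : 4 <= r ->
  (vol3 (hex_cell i `&` eball (r - 4)) <=
   (dens^-1)%:E * vol3 (hex_packing i `&` eball r))%E.
Proof.
case: i => -[m n] b r4; have r0 : 0 <= r by lra.
have r40 : 0 <= r - 4 by lra.
have d0 := @dens_gt0 R; have mr := measurable_eball r0; have mr4 := measurable_eball r40.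
rewrite /hex_packing (half_cylinderE _ (hex_dir_unit b)).
have mP : measurable (hex_cell (m, n, b) `&` eball (r - 4)).
  by apply: measurableI => //; exact: measurable_hex_cell.
have mC : measurable (ccyl (hex_base m n) (hex_dir b) `&` eball r).
  by apply: measurableI => //; exact: measurable_ccyl.
have k0 : 0 <= dens^-1 :> R by rewrite invr_ge0 ltW.
apply: (@le_prod_ysection R _ _ _ _ area lam _ _ _ k0 mP mC).
move=> z.
have [->|/set0P[w0]] := eqVneq (ysection (hex_cell (m, n, b) `&` eball (r - 4)) z) set0.
  by rewrite measure0 mule_ge0// lee_fin invr_ge0 ltW.
rewrite /ysection /= inE => -[[bw0 zb] zr].
have my1 := measurable_ysection z mP; have my2 := measurable_ysection z mC.
pose v := lattice m n.
have mD : measurable (disc true 1) := measurable_disc true 1.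
have s3 := @sqrt3_gt0 R; have s3' := @sqrt3_sqr R.
have mbr := measurable_brick.
have mshift (A : set R2) : measurable A -> measurable [set w : R2 | A (w.1 - v.1, w.2 - v.2)].
  by move=> mA; apply: (measurable_preimage (preserves_shift2 (- v.1, - v.2)).1 mA).
apply: (@le_trans _ _ (2 * Num.sqrt 3)%:E).
  rewrite -area_brick -(area_shift v mbr); apply: (le_measure area); rewrite ?inE.
  - exact: my1.
  - exact: mshift.
  by move=> w; rewrite /ysection /= inE => -[[]].
apply: (@le_trans _ _ (dens^-1%:E * (pi * 1 ^+ 2)%:E)%E).
  rewrite -EFinM lee_fin /dens expr1n mulr1 invf_div divfK// gt_eqF//; exact: pi_gt0.
apply: lee_wpmul2l; first by rewrite lee_fin invr_ge0 ltW.
rewrite -(@area_disc R false 1 ler01) -(area_shift v (measurable_disc _ _)).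
apply: (le_measure area); rewrite ?inE.
- exact: (mshift _ (measurable_disc false 1)).
- exact: my2.
move=> w; rewrite /disc /lt_or_le /= expr1n => w1; rewrite /ysection /= inE; split.
  rewrite /ccyl /= hex_axial hex_lateral; split; last exact: w1.
  by move: zb; clear; case: b => /=; lra.
move: zr; rewrite !eballE//= => zr.
have -> : (w, z) = (w0, z) + ((w, z) - (w0, z)) :> R3 R by R3_ring.
rewrite [in leRHS](_ : r = r - 4 + 4); last by ring.
apply: sqr_triangle => //.
case: bw0; rewrite /= !in_itv /= => /andP[x1 x2] /andP[y1 y2].
rewrite /dot /= subrr mul0r addr0.
move: x1 x2 y1 y2 w1; rewrite -/v.
have -> : w.1 - w0.1 = (w.1 - v.1) - (w0.1 - v.1) by ring.
have -> : w.2 - w0.2 = (w.2 - v.2) - (w0.2 - v.2) by ring.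
move: (w.1 - _) (w.2 - _) (w0.1 - _) (w0.2 - _) => a c e f e1 e2 f1 f2 ac.
have : e ^+ 2 <= 1 by rewrite expr2; nra.
have : f ^+ 2 <= 3 by rewrite -s3' ler_sqr ?nnegrE; lra.
have := sqr_ge0 (a + e); have := sqr_ge0 (c + f).
move: ac; clear; rewrite !expr2; lra.
Qed.

Lemma upper_density_hex : ((dens : R)%:E <= upper_density hex_packing)%E.
Proof.
have d0 := @dens_gt0 R.
apply: (@limf_esup_pinfty_ge _ _ _ (12 * dens)); first by rewrite mulr_ge0// ltW.
move=> r r4; have r0 : 0 < r by lra.
have r40 : 0 < r - 4 by lra.
have b0 := ball_vol_gt0 r0; have b4 := ball_vol_gt0 r40.
set f := (\esum_(i in _) _)%E.
have le_f : ((ball_vol (r - 4))%:E <= (dens^-1 * ball_vol r)%:E * f)%E.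
  rewrite /ball_vol -(vol_eball r40) -/(ball_vol r).
  have mb : measurable (eball (r - 4) : set (R3 R)) by exact: measurable_eball (ltW r40).
  apply: (@le_trans _ _ (\esum_(i in [set: int * int * bool])
      vol3 (hex_cell i `&` eball (r - 4)))%E).
    apply: (@measure_le_esum R _ _ vol3) => //.
      by move=> i; apply: measurableI => //; exact: measurable_hex_cell.
    by move=> x xr; have [i xi] := hex_cell_cover x; exists i.
  apply: le_esum_mul => [||i].
  - by rewrite mulr_ge0 ?invr_ge0// ltW.
  - move=> i; rewrite div_vol_eball// mule_ge0 ?lee_fin ?invr_ge0 ?(ltW b0)//.
  rewrite div_vol_eball// muleA -EFinM mulfK ?gt_eqF// volE.
  by apply: vol_hex_cell; exact: ltW.
have k0 : 0 < dens^-1 * ball_vol r by rewrite mulr_gt0// invr_gt0.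
apply: (@le_trans _ _ ((dens^-1 * ball_vol r)^-1%:E * (ball_vol (r - 4))%:E)%E); last first.
  by rewrite lee_pdivrMl.
rewrite -EFinM lee_fin /ball_vol; have p0 := pi_gt0 R.
rewrite [leRHS](_ : _ = dens * (r - 4) ^+ 3 / r ^+ 3); last first.
  move: (pi : R) (dens : R) p0 d0 => q d q0 d0; field.
  by rewrite !gt_eqF//.
rewrite ler_pdivlMr ?exprn_gt0//.
rewrite (_ : (_ - _ / r) * _ = dens * (r ^+ 3 - 12 * r ^+ 2)); last first.
  by move: (dens : R) => d; field; rewrite gt_eqF.
rewrite ler_pM2l// -subr_ge0 (_ : _ - _ = 16 * (3 * r - 4)); last by ring.
by rewrite mulr_ge0//; lra.
Qed.

End Hexagonal.

(** * The least upper bound of the densities *)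

Theorem theorem17 (R : realType) :
  ereal_sup [set g : \bar R | exists (I : countType) (C : I -> set (R3 R)),
    packing C /\ g = upper_density C] = (pi / Num.sqrt 12%:R)%:E.
Proof.
have s12 : Num.sqrt 12%:R = 2 * Num.sqrt 3 :> R.
  have s3 := ltW (@sqrt3_gt0 R).
  rewrite -[RHS]ger0_norm ?mulr_ge0// -sqrtr_sqr exprMn sqrt3_sqr.
  by congr Num.sqrt; ring.
rewrite s12 -/dens; apply/le_anti/andP; split.
  by apply: ge_ereal_sup => _ [I [C [pC ->]]]; exact: upper_density_le.
apply: (le_trans upper_density_hex); apply: ereal_sup_ubound.
by exists (int * int * bool)%type, hex_packing; split => //; exact: packing_hex.
Qed.
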